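(* Let $\alpha$ be an epsilon number and $B\subseteq\alpha^+$ finite with $B\cap[\alpha,\alpha^+)\neq\emptyset$. Let $FB$ be the set of all $(<,<_1,+)$-isomorphisms $h:\Delta(\alpha,B)\to h[\Delta(\alpha,B)]\subseteq\alpha$ with $h(x)=x$ for all $x\in\Delta(\alpha,B)\cap\alpha$. Then for every $h\in FB$ we have $h(\alpha)\in\alpha\cap\mathbb{E}$ and: (a) for all $x\in\Delta(\alpha,B)$: $\mathrm{Ep}(x)\cap\alpha\subseteq h(\alpha)$ and $x[\alpha:=h(\alpha)]\le h(x)$; (b) if $\alpha\le_1\max\Delta(\alpha,B)$, then the map $H:\Delta(\alpha,B)\to H[\Delta(\alpha,B)]$, $H(x):=x[\alpha:=h(\alpha)]$, is an $(<,<_1,+,\lambda x.\omega^x)$-isomorphism with $H(x)=x$ for all $x\in\Delta(\alpha,B)\cap\alpha$.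
   Context: $\mathbb{P}=\{\omega^\xi\}$; $\mathbb{E}$ = epsilon numbers; $x^+:=\min\{e\in\mathbb{E}:e>x\}$; $x=_{\mathrm{CNF}}L_1l_1+\dots+L_nl_n$ is Cantor normal form ($L_1>\dots>L_n$ in $\mathbb{P}$, $0<l_i<\omega$). $\mathrm{Ep}(x)$: $\{x\}$ if $x\in\mathbb{E}$; $\mathrm{Ep}(L_1)\cup\dots\cup\mathrm{Ep}(L_n)$ if $x\notin\mathbb{E}$, $x=_{\mathrm{CNF}}L_1l_1+\dots+L_nl_n$, $n\ge2$ or $l_1\ge2$; $\mathrm{Ep}(L)$ if $x\notin\mathbb{E}$, $x=_{\mathrm{CNF}}\omega^L$; $\mathrm{Ep}(0)=\emptyset$. Substitution for $\alpha,e\in\mathbb{E}$: $x[\alpha:=e]=x$ if $x\in\mathbb{E}\setminus\{\alpha\}$; $=e$ if $x=\alpha$; $=L_1[\alpha:=e]l_1+\dots+L_n[\alpha:=e]l_n$ if $x\notin\mathbb{E}$, $x=_{\mathrm{CNF}}L_1l_1+\dots+L_nl_n$, $n\ge2$ or $l_1\ge2$; $=\omega^{L[\alpha:=e]}$ if $x\notin\mathbb{E}$, $x=_{\mathrm{CNF}}\omega^L$. Cover sets: For $L\in\mathbb{P}$: if $L\in\mathbb{E}\cup\{1\}$, $F(L):=\{L\}$; if $L=\omega^Z\notin\mathbb{E}$ with $Z=_{\mathrm{CNF}}\sum_{j=1}^k\omega^{V_j}v_j$, then $F(L):=\{\omega^{\omega^{V_1}v_1+\dots+\omega^{V_{g-1}}v_{g-1}+\omega^{V_g}\cdot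 j} : g\in[1,k], j\in[1,v_g]\}\cup\{\omega^{\omega^{V_1}v_1+\dots+\omega^{V_{g-1}}v_{g-1}+\omega^{V_g}\cdot j}+V_g : g\in[1,k], j\in[1,v_g]\}$. For $\delta=_{\mathrm{CNF}}L_1l_1+\dots+L_nl_n$: $C_1(\delta):=\bigcup_{L_i\notin\mathbb{E}}F(L_i)$; $C_2(\delta):=\{L_ij: i\in[1,n], j\in[1,l_i]\}\cup\{\sum_{i=1}^jL_il_i: j\in[1,n]\}$; $Y(\delta):=\{V_{ij}: L_i\notin\mathbb{E}, L_i=\omega^Z, Z=_{\mathrm{CNF}}\sum_{j}\omega^{V_{ij}}v_{ij}\}$; and recursively $C(\delta):=C_1(\delta)\cup\bigcup_{\sigma\in C_1(\delta)}C_2(\sigma)\cup C_2(\delta)\cup\bigcup_{V\in Y(\delta)}C(V)$. For $\delta<\alpha^+$: $D(\alpha,\delta):=C(\delta)\cup\{\alpha,\alpha\cdot2\}$; for finite $B\subseteq\alpha^+$: $\Delta(\alpha,B):=B\cup\bigcup_{\delta\in B\cap[\alpha,\alpha^+)}D(\alpha,\delta)$. For finite $Z,\tilde Z$, a bijection $h:Z\to\tilde Z$ is an $(<,<_1,+)$-isomorphism if for $x,y,z\in Z$: $x<y\iff h(x)<h(y)$, $x<_1y\iff h(x)<_1h(y)$, $x+y=z\iff h(x)+h(y)=h(z)$; an $(<,<_1,+,\lambda x.\omega^x)$-isomorphism if also $\omega^x=y\iff\omega^{h(x)}=h(y)$. Carlson's $<_1$ (recursion on $\beta$): $\alpha<_1\beta$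 iff $\alpha<\beta$ and every finite $B\subseteq\beta$ admits an $(<,<_1,+)$-isomorphism $h:B\to h[B]\subseteq\alpha$ fixing $B\cap\alpha$ pointwise; $\alpha\le_1\beta$ iff $\alpha<_1\beta$ or $\alpha=\beta$. *)

(* Defs.v *)
(* Ordinals are modelled abstractly: an [OrdStr] is a
   well-ordered type equipped with ordinal addition and omega-exponentiation,
   each characterised (uniquely, by rigidity of well-orders) as an order
   isomorphism onto the appropriate subset.  Any such structure is isomorphic
   to an epsilon number (as an ordinal) with its genuine ordinal operations. *)
From Stdlib Require Import List Arith Wellfounded Sorted.
Import ListNotations.

Set Implicit Arguments.

Record OrdStr := {
  carrier :> Type;
  olt : carrier -> carrier -> Prop;
  olt_wf : well_founded olt;
  olt_trans : forall x y z, olt x y -> olt y z -> olt x z;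
  olt_total : forall x y, olt x y \/ x = y \/ olt y x;
  ozero : carrier;
  ozero_least : forall x, ~ olt x ozero;
  oadd : carrier -> carrier -> carrier;
  (* y |-> x + y is an order isomorphism from the whole type onto [x, oo) *)
  oadd_mono : forall x y y', olt y y' -> olt (oadd x y) (oadd x y');
  oadd_ge : forall x y, ~ olt (oadd x y) x;
  oadd_onto : forall x z, ~ olt z x -> exists y, oadd x y = z;
  oexp : carrier -> carrier;
  (* omega^. is an order isomorphism onto the additive principal numbers *)
  oexp_mono : forall x y, olt x y -> olt (oexp x) (oexp y);
  oexp_P : forall x, oexp x <> ozero /\
     (forall a b, olt a (oexp x) -> olt b (oexp x) -> olt (oadd a b) (oexp x));
  oexp_onto : forall z, z <> ozero ->
     (forall a b, olt a z -> olt b z -> olt (oadd a b) z) -> exists x, oexp x = z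
}.

Arguments olt {o}.
Arguments ozero {o}.
Arguments oadd {o}.
Arguments oexp {o}.

Section Defs.
Context {T : OrdStr}.

Definition ole (x y : T) : Prop := olt x y \/ x = y.

Definition oone : T := oexp ozero.

Definition isP (z : T) : Prop :=
  z <> ozero /\ forall a b, olt a z -> olt b z -> olt (oadd a b) z.

Definition is_eps (x : T) : Prop := oexp x = x.

Definition next_eps (x ap : T) : Prop :=
  is_eps ap /\ olt x ap /\ forall e, is_eps e -> olt x e -> ole ap e.

Fixpoint natmul (L : T) (l : nat) : T :=
  match l with
  | O => ozero
  | S l' => oadd (natmul L l') L
  end.

Definition cnfsum (s : list (T * nat)) : T :=
  fold_right (fun p acc => oadd (natmul (fst p) (snd p)) acc) ozero s.

Definition is_cnf (x : T) (s : list (T * nat)) : Prop :=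
  Forall (fun p => isP (fst p) /\ 0 < snd p) s /\
  StronglySorted (fun p q => olt (fst q) (fst p)) s /\
  x = cnfsum s.

Definition cnf_nontrivial (s : list (T * nat)) : Prop :=
  2 <= length s \/ exists L l, s = [(L, l)] /\ 2 <= l.

Inductive InEp : T -> T -> Prop :=
| Ep_eps : forall x, is_eps x -> InEp x x
| Ep_sum : forall x s L l e, ~ is_eps x -> is_cnf x s -> cnf_nontrivial s ->
    In (L, l) s -> InEp e L -> InEp e x
| Ep_exp : forall x L e, ~ is_eps x -> x = oexp L -> InEp e L -> InEp e x.

Inductive Subst (a e : T) : T -> T -> Prop :=
| Sub_other : forall x, is_eps x -> x <> a -> Subst a e x x
| Sub_alpha : Subst a e a e
| Sub_sum : forall x s ys, ~ is_eps x -> is_cnf x s -> cnf_nontrivial s ->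
    length ys = length s ->
    (forall i, i < length s -> Subst a e (fst (nth i s (ozero, 0))) (nth i ys ozero)) ->
    Subst a e x (cnfsum (combine ys (map snd s)))
| Sub_exp : forall x L y, ~ is_eps x -> x = oexp L -> Subst a e L y ->
    Subst a e x (oexp y)
| Sub_zero : Subst a e ozero ozero.

Definition InF (L sigma : T) : Prop :=
  ((is_eps L \/ L = oone) /\ sigma = L) \/
  (~ is_eps L /\ L <> oone /\
   exists Z s g j, L = oexp Z /\ is_cnf Z s /\ g < length s /\
     1 <= j <= snd (nth g s (ozero, 0)) /\
     let pre := oadd (cnfsum (firstn g s)) (natmul (fst (nth g s (ozero, 0))) j) in
     (sigma = oexp pre \/
      exists V, oexp V = fst (nth g s (ozero, 0)) /\ sigma = oadd (oexp pre) V)).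

Definition InC1 (d x : T) : Prop :=
  exists s L l, is_cnf d s /\ In (L, l) s /\ ~ is_eps L /\ InF L x.

Definition InC2 (d x : T) : Prop :=
  exists s, is_cnf d s /\
   ((exists L l j, In (L, l) s /\ 1 <= j <= l /\ x = natmul L j) \/
    (exists j, 1 <= j <= length s /\ x = cnfsum (firstn j s))).

Definition InY (d V : T) : Prop :=
  exists s L l Z t M v, is_cnf d s /\ In (L, l) s /\ ~ is_eps L /\
    L = oexp Z /\ is_cnf Z t /\ In (M, v) t /\ oexp V = M.

Inductive InC (d : T) : T -> Prop :=
| C_1 : forall x, InC1 d x -> InC d x
| C_12 : forall sigma x, InC1 d sigma -> InC2 sigma x -> InC d x
| C_2 : forall x, InC2 d x -> InC d x
| C_Y : forall V x, InY d V -> InC V x -> InC d x.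

Definition InD (a d x : T) : Prop := InC d x \/ x = a \/ x = oadd a a.

Definition InDelta (a ap : T) (B : list T) (x : T) : Prop :=
  In x B \/ exists d, In d B /\ ole a d /\ olt d ap /\ InD a d x.

(* Carlson's <_1, by well-founded recursion on the right argument *)
Definition lt1_F (b : T) (rec : forall b', olt b' b -> T -> Prop) (a : T) : Prop :=
  olt a b /\
  forall B : list T, (forall x, In x B -> olt x b) ->
    exists h : T -> T,
      (forall x, In x B -> olt (h x) a) /\
      (forall x, In x B -> olt x a -> h x = x) /\
      (forall x y, In x B -> In y B -> h x = h y -> x = y) /\
      (forall x y, In x B -> In y B -> (olt x y <-> olt (h x) (h y))) /\
      (forall x y (Hy : olt y b) (Hhy : olt (h y) b), In x B -> In y B ->
          (rec y Hy x <-> rec (h y) Hhy (h x))) /\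
      (forall x y z, In x B -> In y B -> In z B ->
          (oadd x y = z <-> oadd (h x) (h y) = h z)).

Definition lt1 (a b : T) : Prop :=
  Fix (@olt_wf T) (fun _ => T -> Prop) lt1_F b a.

Definition le1 (a b : T) : Prop := lt1 a b \/ a = b.

Definition iso_lt_lt1_add (Z : T -> Prop) (h : T -> T) : Prop :=
  (forall x y, Z x -> Z y -> h x = h y -> x = y) /\
  (forall x y, Z x -> Z y -> (olt x y <-> olt (h x) (h y))) /\
  (forall x y, Z x -> Z y -> (lt1 x y <-> lt1 (h x) (h y))) /\
  (forall x y z, Z x -> Z y -> Z z -> (oadd x y = z <-> oadd (h x) (h y) = h z)).

Definition iso_lt_lt1_add_exp (Z : T -> Prop) (h : T -> T) : Prop :=
  iso_lt_lt1_add Z h /\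
  (forall x y, Z x -> Z y -> (oexp x = y <-> oexp (h x) = h y)).

End Defs.

(* Main.v *)
Require Import Defs.
From Stdlib Require Import List Arith Lia Wellfounded Sorted.
From Stdlib Require Import Classical ClassicalEpsilon FunctionalExtensionality.
Import ListNotations.

(** Only additive principal numbers have proper [<_1]-successors, and for
    [X = oexp d > 1] and [V <= X] one has [X <=_1 X + V] if [d] is a multiple of [oexp V],
    while [X <_1 X + V] forces [d] to be such a multiple: finite sets below [X + V] are
    reflected by shifting [X + w] to [oexp (z + oexp b) + w] with [w <= b < V] and [z]
    large, whereas a last term [oexp W] of [d] with [W < V] would be shortened by any
    reflection.  With [V = X] this says that [X <_1 X + X] iff [X] is an epsilon number,
    so [e := h alpha] is one.

    The cover sets contain, along every initial part [pre] of an exponent ending in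
    [oexp V], the points [oexp pre], [V] and [oexp pre + V]; as [oexp pre <=_1 oexp pre + V]
    is preserved by [h], the exponent of [h (oexp pre)] is a multiple of [oexp (h V)], and
    induction gives [x[alpha := e] <= h x].

    The substitution [alpha := e] is an isomorphism for [<], [+] and [oexp]; its inverse
    is defined on all ordinals below the epsilon number after [e].  It also respects
    [x <_1 y]: for [x > alpha] because this is a formula in the exponent of [x], and for
    [x <= alpha] because [alpha <=_1 y] and [e <=_1 y[alpha := e] <= h y]. *)

Set Implicit Arguments.
Unset Strict Implicit.

Declare Scope ord_scope.
Local Open Scope ord_scope.
Local Notation "x << y" := (olt x y) (at level 70) : ord_scope.
Local Notation "x <<= y" := (ole x y) (at level 70) : ord_scope.
Local Notation "x [+] y" := (oadd x y) (at level 50, left associativity) : ord_scope.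

(** * Ordinal arithmetic *)

Section Order.
Context {T : OrdStr}.
Implicit Types x y z a b c : T.

Lemma olt_irrefl x : x << x -> False.
Proof.
  induction x as [x IH] using (well_founded_ind (@olt_wf T)).
  intro H; exact (IH x H H).
Qed.

Lemma olt_ole x y : x << y -> x <<= y.
Proof. now left. Qed.

Lemma ole_refl x : x <<= x.
Proof. now right. Qed.

Lemma olt_or_ge x y : x << y \/ y <<= x.
Proof. destruct (olt_total T x y) as [H|[H|H]]; unfold ole; subst; auto. Qed.

Lemma not_olt x y : ~ x << y -> y <<= x.
Proof. destruct (olt_or_ge x y); tauto. Qed.

Lemma ole_olt_trans x y z : x <<= y -> y << z -> x << z.
Proof. intros [H|H] H'; subst; eauto using olt_trans. Qed.

Lemma olt_ole_trans x y z : x << y -> y <<= z -> x << z.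
Proof. intros H [H'|H']; subst; eauto using olt_trans. Qed.

Lemma ole_trans x y z : x <<= y -> y <<= z -> x <<= z.
Proof. intros [H|H] H'; subst; auto. left; eapply olt_ole_trans; eauto. Qed.

Lemma ole_antisym x y : x <<= y -> y <<= x -> x = y.
Proof.
  intros [H|H] [H'|H']; auto.
  destruct (olt_irrefl (olt_trans T _ _ _ H H')).
Qed.

Lemma ole_neq_olt x y : x <<= y -> x <> y -> x << y.
Proof. intros [H|H]; tauto. Qed.

Lemma least_element (P : T -> Prop) :
  (exists x, P x) -> exists x, P x /\ forall y, P y -> x <<= y.
Proof.
  intros [x Hx].
  induction x as [x IH] using (well_founded_ind (@olt_wf T)).
  destruct (classic (exists y, P y /\ y << x)) as [[y [Hy Hyx]]|Hn]; [eauto|].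
  exists x; split; [assumption|]; intros y Hy.
  apply not_olt; intro; apply Hn; eauto.
Qed.

End Order.

(** [ord] refutes the negated goal by closing the hypotheses under transitivity until some [a << a]
    or [a << ozero] appears; [ord_add] refuses facts already present, so the saturation stops. *)
Ltac ord_known P :=
  match goal with _ : P |- _ => idtac end.
Ltac ord_add P pf :=
  tryif ord_known P then fail else assert P by exact pf.
Ltac ord_sat :=
  repeat match goal with
  | H : ?a << ?a |- _ => destruct (olt_irrefl H)
  | H : ?a << ozero |- _ => destruct (ozero_least _ _ H)
  | H : ~ ?a << ?b |- _ => apply not_olt in H
  | H : ?a << ?b, H' : ?b << ?c |- _ => ord_add (a << c) (olt_trans _ _ _ _ H H')
  | H : ?a <<= ?b, H' : ?b << ?c |- _ => ord_add (a << c) (ole_olt_trans H H')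
  | H : ?a << ?b, H' : ?b <<= ?c |- _ => ord_add (a << c) (olt_ole_trans H H')
  | H : ?a <<= ?b, H' : ?b <<= ?c |- _ =>
      tryif unify a c then fail else ord_add (a <<= c) (ole_trans H H')
  end.
Ltac ord :=
  intros; subst;
  match goal with
  | |- ?a << ?b => let H := fresh in destruct (olt_or_ge a b) as [H|H]; [exact H|exfalso]
  | |- ?a <<= ?b => let H := fresh in destruct (olt_or_ge b a) as [H|H]; [exfalso|exact H]
  | |- ~ _ => intro
  | |- _ => exfalso
  end; ord_sat.

Section Arith.
Context {T : OrdStr}.
Implicit Types x y z a b c d : T.

Lemma ozero_ole x : ozero <<= x.
Proof. apply not_olt, ozero_least. Qed.

Lemma ozero_olt x : x <> ozero -> ozero << x.
Proof. intro H; apply ole_neq_olt; auto using ozero_ole. Qed.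

Lemma olt_neq_ozero x y : x << y -> y <> ozero.
Proof. intros H ->; exact (ozero_least _ _ H). Qed.

Lemma mono_inv (F : T -> T) : (forall x y, x << y -> F x << F y) ->
  forall x y, F x << F y -> x << y.
Proof.
  intros HF x y H. destruct (olt_or_ge x y) as [|[Hl| ->]]; auto.
  - specialize (HF _ _ Hl). ord.
  - ord.
Qed.

Lemma mono_inj (F : T -> T) : (forall x y, x << y -> F x << F y) ->
  forall x y, F x = F y -> x = y.
Proof.
  intros HF x y H.
  destruct (olt_total T x y) as [Hl|[Hl|Hl]]; auto; apply HF in Hl; rewrite H in Hl; ord.
Qed.

Lemma mono_ole (F : T -> T) : (forall x y, x << y -> F x << F y) ->
  forall x y, x <<= y -> F x <<= F y.
Proof. intros HF x y [H| ->]; [left; auto|right; auto]. Qed.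

Lemma mono_ole_id (F : T -> T) : (forall x y, x << y -> F x << F y) ->
  forall x, x <<= F x.
Proof.
  intros HF x. induction x as [x IH] using (well_founded_ind (@olt_wf T)).
  apply not_olt; intro H. pose proof (IH _ H) as H1. pose proof (HF _ _ H). ord.
Qed.

(** Rigidity of well-orders: at a first disagreement the smaller value would already be taken by the
    other function at an earlier argument. Addition is axiomatised only through the order, so its
    algebraic laws come from here. *)
Lemma mono_same_range (F G : T -> T) :
  (forall x y, x << y -> F x << F y) -> (forall x y, x << y -> G x << G y) ->
  (forall x, exists y, F x = G y) -> (forall x, exists y, G x = F y) ->
  forall x, F x = G x.
Proof.
  intros HF HG FG GF x. induction x as [x IH] using (well_founded_ind (@olt_wf T)).
  destruct (olt_total T (F x) (G x)) as [H|[H|H]]; auto; exfalso.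
  - destruct (FG x) as [y Hy]. rewrite Hy in H. apply (mono_inv HG) in H.
    rewrite <- (IH y H) in Hy. apply (mono_inj HF) in Hy. ord.
  - destruct (GF x) as [y Hy]. rewrite Hy in H. apply (mono_inv HF) in H.
    rewrite (IH y H) in Hy. apply (mono_inj HG) in Hy. ord.
Qed.

Lemma oadd_lt_inv x y z : x [+] y << x [+] z -> y << z.
Proof. apply mono_inv, oadd_mono. Qed.

Lemma oadd_cancel x y z : x [+] y = x [+] z -> y = z.
Proof. apply mono_inj, oadd_mono. Qed.

Lemma oadd_ole x y z : y <<= z -> x [+] y <<= x [+] z.
Proof. apply mono_ole, oadd_mono. Qed.

Lemma ole_oadd_l x y : x <<= x [+] y.
Proof. apply not_olt, oadd_ge. Qed.

Lemma ole_oadd_r x y : y <<= x [+] y.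
Proof. apply (mono_ole_id (oadd_mono T x)). Qed.

Lemma oadd_sub x y : x <<= y -> exists z, x [+] z = y.
Proof. intro; apply oadd_onto. ord. Qed.

Lemma oadd_0_r x : x [+] ozero = x.
Proof.
  destruct (oadd_sub (ole_refl x)) as [z Hz].
  apply ole_antisym; [|apply ole_oadd_l].
  rewrite <- Hz at 2. apply oadd_ole, ozero_ole.
Qed.

Lemma oadd_0_l x : ozero [+] x = x.
Proof.
  apply (mono_same_range (F := oadd ozero) (G := fun x => x)); eauto using oadd_mono.
  intro y. destruct (oadd_sub (ozero_ole y)) as [z Hz]. eauto.
Qed.

Lemma oadd_assoc x y z : x [+] y [+] z = x [+] (y [+] z).
Proof.
  (* As functions of [z], both sides range over exactly the ordinals from [x [+] y] on. *)
  apply (mono_same_range (F := oadd (x [+] y)) (G := fun z => x [+] (y [+] z)));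
    auto using oadd_mono; clear z; intro z.
  - destruct (@oadd_sub x (x [+] y [+] z)) as [w Hw].
    { eapply ole_trans; [|apply ole_oadd_l]. apply ole_oadd_l. }
    destruct (@oadd_sub y w) as [v Hv].
    { apply not_olt; intro H. apply (oadd_mono T x) in H.
      pose proof (ole_oadd_l (x [+] y) z). rewrite Hw in *. ord. }
    exists v. now rewrite Hv.
  - destruct (@oadd_sub (x [+] y) (x [+] (y [+] z))) as [w Hw]; eauto.
    apply oadd_ole, ole_oadd_l.
Qed.

Lemma oadd_ole_mono x x' y y' : x <<= x' -> y <<= y' -> x [+] y <<= x' [+] y'.
Proof.
  intros Hx Hy. destruct (oadd_sub Hx) as [d <-]. rewrite oadd_assoc.
  apply oadd_ole. eapply ole_trans; [exact Hy|apply ole_oadd_r].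
Qed.

Lemma olt_oadd x y : y <> ozero -> x << x [+] y.
Proof. intro H. rewrite <- (oadd_0_r x) at 1. apply oadd_mono, ozero_olt, H. Qed.

Lemma oexp_lt_inv x y : oexp x << oexp y -> x << y.
Proof. apply mono_inv, oexp_mono. Qed.

Lemma oexp_inj x y : oexp x = oexp y -> x = y.
Proof. apply mono_inj, oexp_mono. Qed.

Lemma oexp_ole x y : x <<= y -> oexp x <<= oexp y.
Proof. apply mono_ole, oexp_mono. Qed.

Lemma ole_oexp x : x <<= oexp x.
Proof. apply (mono_ole_id (oexp_mono T)). Qed.

Lemma oexp_neq_ozero x : oexp x <> ozero.
Proof. apply oexp_P. Qed.

Lemma oexp_add_lt x a b : a << oexp x -> b << oexp x -> a [+] b << oexp x.
Proof. apply oexp_P. Qed.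

Lemma isP_oexp x : isP (oexp x).
Proof. apply oexp_P. Qed.

Lemma isP_ex x : isP x -> exists c, x = oexp c.
Proof. intros [H1 H2]. destruct (oexp_onto T H1 H2); eauto. Qed.

(** The [d] with [a [+] d = oexp c] is not below [oexp c], because sums of smaller ordinals stay
    below. *)
Lemma absorb a c : a << oexp c -> a [+] oexp c = oexp c.
Proof.
  intro H. destruct (oadd_sub (olt_ole H)) as [d Hd].
  apply ole_antisym; [|apply ole_oadd_r].
  apply not_olt; intro H1. rewrite <- Hd in H1 at 1.
  apply oadd_lt_inv in H1. pose proof (oexp_add_lt H H1). rewrite Hd in *. ord.
Qed.

(** The least nonzero ordinal is principal, as only zero lies below it; hence it is a value of
    [oexp], and [oexp ozero] is the least of these. *)
Lemma oone_least x : x <> ozero -> oone <<= x.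
Proof.
  intro Hx. destruct (@least_element T (fun y => y <> ozero)) as [y [Hy Hm]]; [eauto|].
  apply ole_trans with y; [|auto].
  destruct (@isP_ex y) as [c ->].
  - split; auto. intros a b Ha Hb.
    assert (a = ozero) as ->. { apply NNPP; intro H; apply Hm in H. ord. }
    now rewrite oadd_0_l.
  - apply oexp_ole, ozero_ole.
Qed.

Definition osucc x : T := x [+] oone.

Lemma olt_osucc x : x << osucc x.
Proof. apply olt_oadd, oexp_neq_ozero. Qed.

Lemma osucc_ole x y : x << y -> osucc x <<= y.
Proof.
  intro H. destruct (oadd_sub (olt_ole H)) as [d <-].
  apply oadd_ole, oone_least. intros ->. rewrite oadd_0_r in H. ord.
Qed.

Lemma olt_osucc_ole x y : x << osucc y -> x <<= y.
Proof. intro H; apply not_olt; intro H1; apply osucc_ole in H1. ord. Qed.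

(** * Logarithms and leading terms *)

Lemma not_isP_sum x : x <> ozero -> ~ isP x ->
  exists a b, a << x /\ b << x /\ a [+] b = x.
Proof.
  intros Hx HP. apply NNPP; intro Hn. apply HP; split; [assumption|].
  intros a b Ha Hb. destruct (olt_or_ge (a [+] b) x) as [H|H]; [assumption|exfalso].
  destruct (oadd_sub (olt_ole Ha)) as [b' Hb']. apply Hn; exists a, b'; repeat split; auto.
  apply ole_olt_trans with b; [|assumption].
  apply not_olt; intro H1; apply (oadd_mono T a) in H1. ord.
Qed.

(** A non-principal [x] is a sum of two smaller ordinals; the larger of their logarithms serves for
    [x], since [oexp (osucc c)] is closed under addition. *)
Lemma log_ex x : x <> ozero -> exists c, oexp c <<= x /\ x << oexp (osucc c).
Proof.
  induction x as [x IH] using (well_founded_ind (@olt_wf T)). intro Hx.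
  destruct (classic (isP x)) as [HP|HP].
  - destruct (isP_ex HP) as [c ->]. exists c. split; [apply ole_refl|].
    apply oexp_mono, olt_osucc.
  - destruct (not_isP_sum Hx HP) as (a & b & Ha & Hb & Hab).
    destruct (IH a Ha) as (c1 & L1 & U1). { intros ->. rewrite oadd_0_l in Hab. ord. }
    destruct (IH b Hb) as (c2 & L2 & U2). { intros ->. rewrite oadd_0_r in Hab. ord. }
    destruct (olt_or_ge c1 c2) as [H|H].
    + exists c2; split; [ord|]. rewrite <- Hab. apply oexp_add_lt; auto.
      pose proof (oexp_ole (osucc_ole H)). pose proof (oexp_mono T _ _ (olt_osucc c2)). ord.
    + exists c1; split; [ord|]. rewrite <- Hab. apply oexp_add_lt; auto.
      destruct H as [H| ->]; auto.
      pose proof (oexp_ole (osucc_ole H)). pose proof (oexp_mono T _ _ (olt_osucc c1)). ord.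
Qed.

Lemma natmul_add L m n : natmul L (m + n) = natmul L m [+] natmul L n :> T.
Proof.
  induction n as [|n IH]; simpl.
  - now rewrite Nat.add_0_r, oadd_0_r.
  - now rewrite Nat.add_succ_r, <- oadd_assoc, <- IH.
Qed.

Lemma natmul_1 L : natmul L 1 = L :> T.
Proof. apply oadd_0_l. Qed.

Lemma natmul_S_l L n : natmul L (S n) = L [+] natmul L n :> T.
Proof. change (S n) with (1 + n). now rewrite natmul_add, natmul_1. Qed.

Lemma natmul_ole (L : T) m n : m <= n -> natmul L m <<= natmul L n.
Proof.
  intro H. replace n with (m + (n - m)) by lia. rewrite natmul_add. apply ole_oadd_l.
Qed.

(** The least upper bound of the finite multiples is closed under addition, so it is some [oexp d],
    and [c << d]. *)
Lemma oexp_osucc_sup c x : (forall n, natmul (oexp c) n <<= x) -> oexp (osucc c) <<= x.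
Proof.
  intro Hx.
  destruct (@least_element T (fun u => forall n, natmul (oexp c) n <<= u)) as (u & Hu & Hm);
    [eauto|].
  apply ole_trans with u; [|auto].
  assert (Hb : forall a, a << u -> exists n, a << natmul (oexp c) n).
  { intros a Ha. apply NNPP; intro Hn. assert (u <<= a); [|ord].
    apply Hm; intro n. apply not_olt; intro; apply Hn; eauto. }
  assert (Hc : oexp c << u).
  { pose proof (Hu 2) as H. simpl in H. rewrite oadd_0_l in H.
    pose proof (olt_oadd (oexp c) (@oexp_neq_ozero c)). ord. }
  destruct (@isP_ex u) as [d Hd].
  - split; [eauto using olt_neq_ozero|]. intros a b Ha Hb'.
    destruct (Hb a Ha) as [n Hn], (Hb b Hb') as [m Hm'].
    apply olt_ole_trans with (natmul (oexp c) (n + m)); [|auto].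
    rewrite natmul_add. apply ole_olt_trans with (natmul (oexp c) n [+] b).
    + apply oadd_ole_mono; [now left|apply ole_refl].
    + now apply oadd_mono.
  - subst u. apply oexp_ole, osucc_ole, oexp_lt_inv, Hc.
Qed.

(** By iteration [x] absorbs every finite multiple of [oexp c]. This turns absorption equations,
    which isomorphisms preserve, into lower bounds. *)
Lemma absorbing_ge a c x : oexp c <<= a -> a [+] x = x -> oexp (osucc c) <<= x.
Proof.
  intros Ha Hx. apply oexp_osucc_sup.
  assert (Hc : oexp c [+] x = x).
  { apply ole_antisym; [|apply ole_oadd_r]. rewrite <- Hx at 2.
    apply oadd_ole_mono; auto using ole_refl. }
  intro n. rewrite <- (oadd_0_r (natmul _ n)).
  assert (natmul (oexp c) n [+] x = x) as <-.
  { induction n as [|n IH]; simpl; [apply oadd_0_l|]. now rewrite oadd_assoc, Hc. }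
  apply oadd_ole, ozero_ole.
Qed.

(** If the remainder were [x] itself, [x] would absorb [oexp c] and reach [oexp (osucc c)]. The
    clause [b << x] drives the recursions along leading terms. *)
Lemma lead_ex x : x <> ozero ->
  exists c b, x = oexp c [+] b /\ b << oexp (osucc c) /\ b << x.
Proof.
  intro Hx. destruct (log_ex Hx) as (c & Hl & Hu).
  destruct (oadd_sub Hl) as [b Hb]. exists c, b.
  pose proof (ole_oadd_r (oexp c) b) as H. rewrite Hb in H.
  repeat split; auto; [ord|].
  destruct H as [H|H]; auto. subst b.
  pose proof (absorbing_ge (ole_refl _) Hb). ord.
Qed.

Lemma lead_lt c b : b << oexp (osucc c) -> oexp c [+] b << oexp (osucc c).
Proof. intro; apply oexp_add_lt; auto. apply oexp_mono, olt_osucc. Qed.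

Lemma lead_log_ole c b c' b' : b' << oexp (osucc c') ->
  oexp c [+] b <<= oexp c' [+] b' -> c <<= c'.
Proof.
  intros Hb H. pose proof (lead_lt Hb). pose proof (ole_oadd_l (oexp c) b).
  apply olt_osucc_ole, oexp_lt_inv. ord.
Qed.

Lemma lead_unique c b c' b' : b << oexp (osucc c) -> b' << oexp (osucc c') ->
  oexp c [+] b = oexp c' [+] b' -> c = c' /\ b = b'.
Proof.
  intros Hb Hb' H.
  assert (c = c') as ->.
  { apply ole_antisym; eapply lead_log_ole; eauto; rewrite H; apply ole_refl. }
  split; auto. eapply oadd_cancel; eauto.
Qed.

Lemma eps_oexp_lt e x : is_eps e -> x << e -> oexp x << e.
Proof. intros He H. rewrite <- He. now apply oexp_mono. Qed.

Lemma eps_add_lt (e x y : T) : is_eps e -> x << e -> y << e -> x [+] y << e.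
Proof. intros He. rewrite <- He. apply oexp_add_lt. Qed.

Lemma eps_pos (e : T) : is_eps e -> e <> ozero.
Proof. intros <-. apply oexp_neq_ozero. Qed.

Lemma oexp_gt x : ~ is_eps x -> x << oexp x.
Proof. intro H. apply ole_neq_olt; [apply ole_oexp|]. intro E. apply H. now symmetry. Qed.

(** Merges finitely many thresholds below [x] into one; [x0] is the threshold for the empty list. *)
Lemma list_bound (P : T -> T -> Prop) (B : list T) x0 x :
  (forall y m m', P y m -> m <<= m' -> P y m') -> x0 << x ->
  (forall y, In y B -> exists m, m << x /\ P y m) ->
  exists m, m << x /\ x0 <<= m /\ forall y, In y B -> P y m.
Proof.
  intros HP Hx0 HB. induction B as [|a B IH].
  - exists x0; repeat split; auto using ole_refl. intros _ [].
  - destruct IH as (m & Hm & H0 & HmB); [firstorder|].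
    destruct (HB a) as (m' & Hm' & Ha); [now left|].
    destruct (olt_or_ge m m') as [H|H].
    + exists m'; repeat split; [assumption|ord|].
      intros y [->|Hy]; eauto using olt_ole.
    + exists m; repeat split; auto. intros y [->|Hy]; eauto.
Qed.

End Arith.

(** * Cantor normal forms and multiples of principal numbers *)

Section CNF.
Context {T : OrdStr}.
Implicit Types (x y z a b c d V W : T) (s t : list (T * nat)).

Lemma natmul_lt (L : T) c n : L << oexp c -> natmul L n << oexp c.
Proof.
  intro H. induction n as [|n IH]; simpl.
  - apply ozero_olt, oexp_neq_ozero.
  - now apply oexp_add_lt.
Qed.

Lemma is_cnf_nil : is_cnf (@ozero T) [].
Proof. repeat constructor. Qed.

Lemma is_cnf_cons (L : T) n s x : isP L -> 0 < n -> is_cnf x s ->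
  (forall q, In q s -> fst q << L) -> is_cnf (natmul L n [+] x) ((L, n) :: s).
Proof.
  intros HL Hn (HF & HS & ->) Hs. repeat split.
  - constructor; auto.
  - constructor; auto. now apply Forall_forall.
Qed.

Lemma is_cnf_inv (L : T) n s x : is_cnf x ((L, n) :: s) ->
  isP L /\ 0 < n /\ is_cnf (cnfsum s) s /\ (forall q, In q s -> fst q << L) /\
  x = natmul L n [+] cnfsum s.
Proof.
  intros (HF & HS & ->). inversion HF as [|? ? [HL Hn] HF']; subst.
  inversion HS as [|? ? HS' Hs]; subst. rewrite Forall_forall in Hs.
  repeat split; auto; apply HL.
Qed.

Lemma is_cnf_single (L : T) n : isP L -> 0 < n -> is_cnf (natmul L n) [(L, n)].
Proof.
  intros HL Hn. rewrite <- (oadd_0_r (natmul L n)).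
  apply is_cnf_cons; auto using is_cnf_nil. intros _ [].
Qed.

Lemma cnf_lt s x c : is_cnf x s -> (forall q, In q s -> fst q << oexp c) -> x << oexp c.
Proof.
  revert x; induction s as [|[L n] s IH]; intros x Hx Hs.
  - destruct Hx as (_ & _ & ->). apply ozero_olt, oexp_neq_ozero.
  - destruct (is_cnf_inv Hx) as (_ & _ & Hx' & _ & ->). apply oexp_add_lt.
    + apply natmul_lt, (Hs (L, n)). now left.
    + apply IH; auto. intros q Hq; apply Hs; now right.
Qed.

Lemma cnf_term s x (L : T) n : is_cnf x s -> In (L, n) s -> isP L /\ 0 < n /\ L <<= x.
Proof.
  revert x; induction s as [|[M m] s IH]; intros x Hx [].
  - injection H as -> ->. destruct (is_cnf_inv Hx) as (HL & Hn & _ & _ & ->).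
    repeat split; auto; try apply HL. eapply ole_trans; [|apply ole_oadd_l].
    rewrite <- (natmul_1 L) at 1. now apply natmul_ole.
  - destruct (is_cnf_inv Hx) as (_ & _ & Hs & _ & ->).
    destruct (IH _ Hs H) as (HL & Hn & Hle). split; [|split]; auto.
    eapply ole_trans; [exact Hle|apply ole_oadd_r].
Qed.

(** If [M << L], all terms of the second normal form are below the principal number [L], hence so is
    [x]. *)
Lemma cnf_head_ole (L M : T) m n s t x : is_cnf x ((L, m) :: s) -> is_cnf x ((M, n) :: t) ->
  L <<= M.
Proof.
  intros Hx Hx'.
  destruct (@cnf_term _ _ L m Hx) as (HL & _ & Hle); [now left|].
  apply not_olt; intro H. destruct (isP_ex HL) as [c Hc]. rewrite Hc in *.
  assert (x << oexp c); [|ord].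
  apply (cnf_lt Hx'). destruct (is_cnf_inv Hx') as (_ & _ & _ & Ht & _).
  intros q [<-|Hq]; [exact H|]. specialize (Ht q Hq). ord.
Qed.

(** For [n < m] the tail of the second form is below [L], so
    [x << natmul L (S n) <<= natmul L m <<= x]. *)
Lemma cnf_head_coeff (L : T) m n s t x : is_cnf x ((L, m) :: s) -> is_cnf x ((L, n) :: t) ->
  m <= n.
Proof.
  intros Hx Hx'.
  destruct (is_cnf_inv Hx) as (HL & _ & Hs & HsL & E).
  destruct (is_cnf_inv Hx') as (_ & _ & Ht & HtL & E').
  destruct (Nat.le_gt_cases m n) as [|H]; auto. exfalso.
  destruct (isP_ex HL) as [c ->].
  pose proof (cnf_lt Ht HtL) as H1.
  apply (oadd_mono T (natmul (oexp c) n)) in H1. rewrite <- E' in H1.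
  pose proof (natmul_ole (oexp c) H) as H2. simpl in H2.
  pose proof (ole_oadd_l (natmul (oexp c) m) (cnfsum s)) as H3. rewrite <- E in H3. ord.
Qed.

Lemma cnf_unique s t x : is_cnf x s -> is_cnf x t -> s = t.
Proof.
  revert t x; induction s as [|[L m] s IH]; intros [|[M n] t] x Hs Ht; auto.
  - destruct Hs as (_ & _ & ->).
    destruct (@cnf_term _ _ M n Ht) as ([H _] & _ & Hle); [now left|].
    destruct H. apply ole_antisym; auto using ozero_ole.
  - destruct Ht as (_ & _ & ->).
    destruct (@cnf_term _ _ L m Hs) as ([H _] & _ & Hle); [now left|].
    destruct H. apply ole_antisym; auto using ozero_ole.
  - assert (L = M) as -> by (apply ole_antisym; eauto using cnf_head_ole).
    assert (m = n) as -> by (apply Nat.le_antisymm; eauto using cnf_head_coeff).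
    destruct (is_cnf_inv Hs) as (_ & _ & Hs' & _ & E).
    destruct (is_cnf_inv Ht) as (_ & _ & Ht' & _ & E').
    f_equal. apply IH with (cnfsum s); auto.
    replace (cnfsum s) with (cnfsum t); auto.
    apply (@oadd_cancel _ (natmul M n)). congruence.
Qed.

(** Gives existence of normal forms by recursion on leading terms; the control of the new terms
    serves later for the cover points [oexp pre [+] V]. *)
Lemma cnf_add_head (L : T) x s : isP L -> is_cnf x s -> (forall q, In q s -> fst q <<= L) ->
  exists s', is_cnf (L [+] x) s' /\
    forall M n, In (M, n) s' -> M = L \/ exists k, In (M, k) s.
Proof.
  intros HL Hx Hs.
  destruct s as [|[M n] s].
  { exists [(L, 1)]. split.
    - destruct Hx as (_ & _ & ->). simpl. rewrite oadd_0_r.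
      rewrite <- (natmul_1 L) at 1. apply is_cnf_single; auto.
    - intros M n [E|[]]. left; congruence. }
  destruct (is_cnf_inv Hx) as (HM & Hn & Hx' & HsM & ->).
  destruct (Hs (M, n)) as [H|H]; [now left| |]; simpl in H.
  - exists ((L, 1) :: (M, n) :: s). split.
    + rewrite <- (natmul_1 L) at 1. apply is_cnf_cons; auto.
      intros q [<-|Hq]; auto. specialize (HsM q Hq). ord.
    + intros M' n' [E|E]; [left; congruence|eauto].
  - subst M. exists ((L, S n) :: s). split.
    + rewrite <- oadd_assoc, <- natmul_S_l. apply is_cnf_cons; auto with arith.
    + intros M' n' [E|E]; [left; congruence|]. right; exists n'; now right.
Qed.

Lemma cnf_ex x : exists s, is_cnf x s.
Proof.
  induction x as [x IH] using (well_founded_ind (@olt_wf T)).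
  destruct (classic (x = ozero)) as [->|Hx]; [eauto using is_cnf_nil|].
  destruct (lead_ex Hx) as (c & b & E & Hb & Hbx).
  destruct (IH b Hbx) as [s Hs].
  destruct (cnf_add_head (isP_oexp c) Hs) as (s' & Hs' & _).
  - intros [M n] Hq. destruct (cnf_term Hs Hq) as (HM & _ & Hle).
    destruct (isP_ex HM) as [d ->]. simpl. apply oexp_ole, olt_osucc_ole, oexp_lt_inv. ord.
  - exists s'. now rewrite E.
Qed.

Lemma cnfsum_app s t : cnfsum (s ++ t) = cnfsum s [+] cnfsum t.
Proof.
  induction s as [|p s IH]; simpl; [now rewrite oadd_0_l|]. now rewrite IH, oadd_assoc.
Qed.

Lemma firstn_S_nth s k p : k < length s -> firstn (S k) s = firstn k s ++ [nth k s p].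
Proof.
  revert k; induction s as [|q s IH]; intros [|k] H; simpl in *; try lia; auto.
  f_equal. apply IH. lia.
Qed.

Lemma cnfsum_firstn_S s k p : k < length s ->
  cnfsum (firstn (S k) s) = cnfsum (firstn k s) [+] natmul (fst (nth k s p)) (snd (nth k s p)).
Proof.
  intro H. rewrite (firstn_S_nth p H), cnfsum_app. simpl. now rewrite oadd_0_r.
Qed.

(* Both [mult V d] and [multI V d] say that [d] is a nonzero multiple [oexp V * k];
   [multI] is the form that visibly transfers along substitutions. *)
Definition mult V d := d <> ozero /\ forall z, z << d -> z [+] oexp V <<= d.

Inductive multI V : T -> Prop :=
| multI_exp W : V <<= W -> multI V (oexp W)
| multI_add a b : multI V a -> multI V b -> multI V (a [+] b).

Lemma multI_mult V d : multI V d -> mult V d.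
Proof.
  induction 1 as [W H|a b _ [Ha0 Ha] _ [Hb0 Hb]]; split.
  - apply oexp_neq_ozero.
  - intros z Hz. apply ole_trans with (z [+] oexp W).
    + now apply oadd_ole, oexp_ole.
    + rewrite absorb; auto using ole_refl.
  - intro E. apply Ha0. apply ole_antisym; [rewrite <- E; apply ole_oadd_l|apply ozero_ole].
  - intros z Hz. destruct (olt_or_ge z a) as [H|H].
    + apply ole_trans with a; [auto|apply ole_oadd_l].
    + destruct (oadd_sub H) as [w <-]. rewrite oadd_assoc. apply oadd_ole, Hb.
      eapply oadd_lt_inv; eauto.
Qed.

Lemma mult_ole V W d : W <<= V -> mult V d -> mult W d.
Proof.
  intros H [H0 Hd]; split; auto. intros z Hz. specialize (Hd z Hz).
  eapply ole_trans; [|exact Hd]. now apply oadd_ole, oexp_ole.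
Qed.

Lemma mult_add z V : mult V (z [+] oexp V).
Proof.
  split.
  - intro E. apply (@oexp_neq_ozero _ V). apply ole_antisym; [|apply ozero_ole].
    rewrite <- E. apply ole_oadd_r.
  - intros w Hw. destruct (olt_or_ge w z) as [H|H].
    + apply oadd_ole_mono; [now left|apply ole_refl].
    + destruct (oadd_sub H) as [v <-]. apply oadd_lt_inv in Hw.
      rewrite oadd_assoc, absorb; auto using ole_refl.
Qed.

(** The last term of the remainder after the leading term is also that of [d], and its exponent is
    at most the leading one. *)
Lemma last_term_ex d : d <> ozero -> exists c W, d = c [+] oexp W /\ multI W d.
Proof.
  induction d as [d IH] using (well_founded_ind (@olt_wf T)). intro Hd.
  destruct (lead_ex Hd) as (c & b & E & Hb & Hbd).
  destruct (classic (b = ozero)) as [->|Hb0].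
  - exists ozero, c. rewrite oadd_0_l, E, oadd_0_r. split; auto.
    constructor; apply ole_refl.
  - destruct (IH b Hbd Hb0) as (c0 & W & Eb & HW).
    exists (oexp c [+] c0), W. split; [now rewrite oadd_assoc, <- Eb|].
    rewrite E. constructor; auto. constructor.
    apply olt_osucc_ole, oexp_lt_inv.
    pose proof (ole_oadd_r c0 (oexp W)). rewrite <- Eb in *. ord.
Qed.

Lemma multI_natmul V W n : V <<= W -> 0 < n -> multI V (natmul (oexp W) n).
Proof.
  intros H Hn. destruct n as [|n]; [lia|]. clear Hn. induction n as [|n IH].
  - rewrite natmul_1. now constructor.
  - change (multI V (natmul (oexp W) (S n) [+] oexp W)). apply multI_add; [exact IH|now constructor].
Qed.

(** Exponents decrease along a normal form, so every earlier term is a multiple of [oexp V]. *)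
Lemma multI_firstn s x k j V : is_cnf x s -> k < length s -> 0 < j ->
  oexp V = fst (nth k s (ozero, 0)) ->
  multI V (cnfsum (firstn k s) [+] natmul (oexp V) j).
Proof.
  revert x k; induction s as [|[L n] s IH]; intros x k Hx Hk Hj E; [simpl in Hk; lia|].
  destruct (is_cnf_inv Hx) as (HL & Hn & Hs & HsL & _). destruct k as [|k]; simpl in *.
  - rewrite oadd_0_l. apply multI_natmul; auto using ole_refl.
  - rewrite oadd_assoc. constructor.
    + destruct (isP_ex HL) as [W ->]. apply multI_natmul; auto.
      apply olt_ole, oexp_lt_inv. rewrite E. apply HsL, nth_In. lia.
    + eapply IH; eauto. lia.
Qed.

End CNF.

(** * The relation [<_1] *)

Section LtOne.
Context {T : OrdStr}.
Implicit Types (x y z a b c d t V W : T) (B : list T).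

(** The requirements on a reflecting map in the definition of [<_1], with [lt1] itself in place of
    the recursive call; [lt1_unfold] derives injectivity from preservation of order. *)
Definition reflects a B (h : T -> T) :=
  (forall x, In x B -> h x << a) /\
  (forall x, In x B -> x << a -> h x = x) /\
  (forall x y, In x B -> In y B -> (x << y <-> h x << h y)) /\
  (forall x y, In x B -> In y B -> (lt1 x y <-> lt1 (h x) (h y))) /\
  (forall x y z, In x B -> In y B -> In z B -> (x [+] y = z <-> h x [+] h y = h z)).

Lemma lt1_unfold a b : lt1 a b <->
  a << b /\ forall B, (forall x, In x B -> x << b) -> exists h, reflects a B h.
Proof.
  unfold lt1 at 1. rewrite Fix_eq.
  (* [Fix_eq] asks that the body respect pointwise equal recursive calls; by extensionality these
     are equal. *)
  2: { intros x f g E. replace g with f; auto.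
       extensionality y; extensionality p; apply E. }
  split; intros [Hab H]; split; auto; intros B HB; destruct (H B HB) as [h Hh]; exists h.
  - destruct Hh as (H1 & H2 & H3 & H4 & H5 & H6). split; [|split; [|split; [|split]]]; auto.
    intros x y Hx Hy. apply H5; auto. eapply olt_trans; eauto.
  - destruct Hh as (H1 & H2 & H4 & H5 & H6). split; [|split; [|split; [|split; [|split]]]]; auto.
    + intros x y Hx Hy E. destruct (olt_total T x y) as [L|[L|L]]; auto;
        apply H4 in L; auto; rewrite E in L; ord.
    + intros x y _ _ Hx Hy. now apply H5.
Qed.

Lemma lt1_olt a b : lt1 a b -> a << b.
Proof. intro H; apply lt1_unfold in H; apply H. Qed.

Lemma lt1_irrefl a : ~ lt1 a a.
Proof. intro H; apply lt1_olt in H; ord. Qed.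

Lemma lt1_ole_right a b c : lt1 a b -> a << c -> c <<= b -> lt1 a c.
Proof.
  rewrite !lt1_unfold. intros [_ H] Hc Hcb. split; auto.
  intros B HB. apply H. intros x Hx. specialize (HB x Hx). ord.
Qed.

(** Reflect [B] below [b], then the image below [a]; points below [a] are fixed by both maps. *)
Lemma lt1_trans a b c : lt1 a b -> lt1 b c -> lt1 a c.
Proof.
  rewrite !lt1_unfold. intros [Hab H1] [Hbc H2]. split; [ord|]. intros B HB.
  destruct (H2 B HB) as (h & A1 & A2 & A3 & A4 & A5).
  destruct (H1 (map h B)) as (k & C1 & C2 & C3 & C4 & C5).
  { intros x Hx. apply in_map_iff in Hx. destruct Hx as (w & <- & Hw). auto. }
  assert (HI : forall x, In x B -> In (h x) (map h B)) by (intros; now apply in_map).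
  exists (fun x => k (h x)). split; [|split; [|split; [|split]]]; auto.
  - intros x Hx Hxa. rewrite (A2 x) at 1; auto; [|ord].
    rewrite C2; auto. rewrite <- (A2 x); auto. ord.
  - intros x y Hx Hy. rewrite A3; auto.
  - intros x y Hx Hy. rewrite A4; auto.
  - intros x y z Hx Hy Hz. rewrite A5; auto.
Qed.

Lemma le1_lt1_trans a b c : lt1 a b -> le1 b c -> lt1 a c.
Proof. intros H [H'| <-]; eauto using lt1_trans. Qed.

(** If [a = u [+] v] with [u] and [v] below [a], a reflection of these three points fixes [u] and
    [v], hence also [a], which is absurd. There is no room below [a] for the image of zero if [a] is
    zero, nor for that of zero and one if [a] is one. *)
Lemma lt1_principal a b : lt1 a b -> exists d, a = oexp d /\ d <> ozero.
Proof.
  rewrite lt1_unfold. intros [Hab H].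
  assert (Ha : a <> ozero).
  { intros ->. destruct (H [ozero]) as (h & H1 & _).
    - intros x [<-|[]]; auto.
    - specialize (H1 ozero (or_introl eq_refl)). ord. }
  destruct (classic (isP a)) as [HP|HP].
  - destruct (isP_ex HP) as [d ->]. exists d; split; auto. intros ->.
    destruct (H [ozero; oexp ozero]) as (h & H1 & H2 & H3 & _).
    { intros x [<-|[<-|[]]]; auto. pose proof (ozero_olt Ha). ord. }
    assert (Hh : h ozero << h (oexp ozero)).
    { apply (H3 ozero (oexp ozero)); simpl; auto. now apply ozero_olt. }
    specialize (H1 (oexp ozero)); simpl in H1.
    assert (oone <<= h (oexp ozero)) by (apply oone_least; eauto using olt_neq_ozero).
    unfold oone in *. specialize (H1 (or_intror (or_introl eq_refl))). ord.
  - exfalso. destruct (not_isP_sum Ha HP) as (u & v & Hu & Hv & E).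
    destruct (H [u; v; a]) as (h & H1 & H2 & H3 & H4 & H5).
    { intros x [<-|[<-|[<-|[]]]]; auto; ord. }
    pose proof (proj1 (H5 u v a (or_introl eq_refl) (or_intror (or_introl eq_refl))
       (or_intror (or_intror (or_introl eq_refl)))) E) as E'.
    rewrite (H2 u), (H2 v), E in E'; simpl; auto.
    specialize (H1 a); simpl in H1. rewrite <- E' in H1. assert (a << a) by auto. ord.
Qed.

Lemma not_isP_oexp_add c w : w <> ozero -> w << oexp c -> ~ isP (oexp c [+] w).
Proof.
  intros H0 Hw [_ H]. pose proof (olt_oadd (oexp c) H0) as H1.
  assert (H2 : w << oexp c [+] w) by ord. specialize (H _ _ H1 H2). ord.
Qed.

Lemma lt1_oexp_add c w y : w << oexp c -> lt1 (oexp c [+] w) y -> w = ozero.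
Proof.
  intros Hw H. apply NNPP; intro H0. destruct (lt1_principal H) as (d & E & _).
  apply (not_isP_oexp_add H0 Hw). rewrite E. apply isP_oexp.
Qed.

Lemma oone_lt_oexp d : d <> ozero -> oone << oexp d.
Proof. intro H. apply oexp_mono, ozero_olt, H. Qed.

(** A failure of [lt1 y (oexp d)] has a finite witness, which is bounded below [oexp d] and so
    refutes [lt1 y c] for all larger [c] as well. *)
Lemma lt1_limit y d : d <> ozero -> y << oexp d ->
  exists m, m << oexp d /\ forall c, m <<= c -> lt1 y c -> lt1 y (oexp d).
Proof.
  intros Hd Hy. destruct (classic (lt1 y (oexp d))) as [H|H]; [eauto|].
  rewrite lt1_unfold in H. apply not_and_or in H. destruct H as [H|H]; [tauto|].
  apply not_all_ex_not in H. destruct H as [B H]. apply imply_to_and in H.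
  destruct H as [HB Hn].
  destruct (@list_bound T (fun y m => y <<= m) B y (oexp d)) as (m & Hm & Hym & HmB); auto.
  { intros; ord. }
  { intros z Hz; exists z; auto using ole_refl. }
  (* The successor puts [B] strictly below every admissible [c]; [d <> ozero] keeps it below
     [oexp d]. *)
  exists (osucc m). split; [apply oexp_add_lt; auto using oone_lt_oexp|].
  intros c Hc H. destruct Hn. apply lt1_unfold in H. apply H.
  intros x Hx. specialize (HmB x Hx). pose proof (olt_osucc m). ord.
Qed.

(* The reflection shifts [oexp d + w] to [oexp d' + w] and fixes everything below [oexp d]. *)
Lemma shift_reflects d d' B :
  d' << d ->
  (forall u, In u B -> u << oexp d ->
     u << oexp d' /\ (lt1 u (oexp d') -> lt1 u (oexp d))) ->
  (forall w, In (oexp d [+] w) B ->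
     w << oexp d' /\ le1 (oexp d') (oexp d' [+] w) /\ le1 (oexp d) (oexp d [+] w)) ->
  exists h, reflects (oexp d) B h.
Proof.
  intros Hd Hlo Hhi. pose proof (oexp_mono T _ _ Hd) as Hdd.
  set (x := oexp d) in *. set (m := oexp d') in *.
  (* [f] is left subtraction of [x]. *)
  assert (Hsub : exists f, forall w, f (x [+] w) = w).
  { exists (fun z => epsilon (inhabits ozero) (fun w => x [+] w = z)). intro w.
    apply (@oadd_cancel _ x). apply epsilon_spec with (P := fun v => x [+] v = x [+] w); eauto. }
  destruct Hsub as [f Hf].
  set (h := fun z => if excluded_middle_informative (z << x) then z else m [+] f z).
  assert (h_lo : forall u, u << x -> h u = u).
  { intros u Hu. unfold h. destruct excluded_middle_informative; tauto. }
  assert (h_hi : forall w, h (x [+] w) = m [+] w).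
  { intro w. unfold h. destruct excluded_middle_informative as [H|H].
    - destruct (oadd_ge _ _ _ H).
    - now rewrite Hf. }
  assert (Hcases : forall u, u << x \/ exists w, u = x [+] w).
  { intro u. destruct (olt_or_ge u x) as [H|H]; auto.
    destruct (oadd_sub H) as [w <-]; eauto. }
  assert (Habs : forall u, u << x -> In u B -> u [+] x = x /\ u [+] m = m).
  { intros u Hu Hin. split; apply absorb; auto. now apply Hlo. }
  exists h. split; [|split; [|split; [|split]]].
  - intros u Hu. destruct (Hcases u) as [H|[w ->]].
    + now rewrite h_lo.
    + rewrite h_hi. apply oexp_add_lt; auto. destruct (Hhi w Hu) as [Hw _].
      fold m x. ord.
  - auto.
  - intros u v Hu Hv. destruct (Hcases u) as [H|[w ->]], (Hcases v) as [H'|[w' ->]];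
      rewrite ?h_hi, ?h_lo by assumption.
    + tauto.
    + destruct (Hlo u Hu H) as [Hum _]. pose proof (ole_oadd_l x w').
      pose proof (ole_oadd_l m w'). split; intros; ord.
    + destruct (Hlo v Hv H') as [Hum _]. pose proof (ole_oadd_l x w).
      pose proof (ole_oadd_l m w). split; intros; ord.
    + split; intro L; apply oadd_lt_inv in L; now apply oadd_mono.
  - intros u v Hu Hv. destruct (Hcases u) as [H|[w ->]], (Hcases v) as [H'|[w' ->]];
      rewrite ?h_hi, ?h_lo by assumption.
    + tauto.
    + destruct (Hlo u Hu H) as [Hum Hux]. destruct (Hhi w' Hv) as (Hw & _ & Hx).
      pose proof (ole_oadd_l x w'). pose proof (ole_oadd_l m w').
      assert (m [+] w' << x) by (apply oexp_add_lt; fold x; [|ord]; auto).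
      (* Downwards by restriction, as [m [+] w' << x]; upwards through [lt1 u m], the hypothesis on
         low points, and [x <=_1 x [+] w']. *)
      split; intro L.
      * apply lt1_ole_right with (x [+] w'); auto; ord.
      * apply le1_lt1_trans with x; auto. apply Hux.
        apply lt1_ole_right with (m [+] w'); auto.
    + destruct (Hlo v Hv H') as [Hum _]. pose proof (ole_oadd_l x w).
      pose proof (ole_oadd_l m w). split; intro L; apply lt1_olt in L; ord.
    + destruct (Hhi w Hu) as (Hw & _), (Hhi w' Hv) as (Hw' & Hm & Hx).
      split; intro L.
      (* A point with nonzero remainder is not principal, so it has no proper [<_1]-successor. *)
      * assert (w = ozero) as -> by (apply (@lt1_oexp_add d w _) in L; auto; ord).
        rewrite oadd_0_r in *. destruct Hm as [Hm|Hm]; auto.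
        exfalso. assert (w' = ozero) as ->.
        { apply (@oadd_cancel _ m). now rewrite oadd_0_r. }
        rewrite oadd_0_r in L. now apply lt1_irrefl in L.
      * assert (w = ozero) as -> by (apply (@lt1_oexp_add d' w _) in L; auto; ord).
        rewrite oadd_0_r in *. destruct Hx as [Hx|Hx]; auto.
        exfalso. assert (w' = ozero) as ->.
        { apply (@oadd_cancel _ x). now rewrite oadd_0_r. }
        rewrite oadd_0_r in L. now apply lt1_irrefl in L.
  - intros u v w Hu Hv Hw.
    destruct (Hcases u) as [Cu|[u' ->]], (Hcases v) as [Cv|[v' ->]],
      (Hcases w) as [Cw|[w' ->]]; rewrite ?h_hi, ?h_lo by assumption.
    + tauto.
    + assert (u [+] v << x) by now apply oexp_add_lt.
      assert (u [+] v << m) by (apply oexp_add_lt; now apply Hlo).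
      pose proof (ole_oadd_l x w'). pose proof (ole_oadd_l m w').
      split; intro E; rewrite E in *; ord.
    + destruct (Habs u Cu Hu) as [Ex Em]. rewrite <- !oadd_assoc, Ex, Em.
      pose proof (ole_oadd_l x v'). pose proof (ole_oadd_l m v').
      assert (w << m) by now apply Hlo.
      split; intro E; rewrite E in *; ord.
    + destruct (Habs u Cu Hu) as [Ex Em]. rewrite <- !oadd_assoc, Ex, Em.
      split; intro E; apply oadd_cancel in E; now rewrite E.
    + rewrite !oadd_assoc. pose proof (ole_oadd_l x (u' [+] v)).
      pose proof (ole_oadd_l m (u' [+] v)).
      assert (w << m) by now apply Hlo.
      split; intro E; rewrite E in *; ord.
    + rewrite !oadd_assoc. split; intro E; apply oadd_cancel in E; now rewrite E.
    + assert (w << m) by now apply Hlo.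
      pose proof (ole_oadd_l (x [+] u') (x [+] v')). pose proof (ole_oadd_l x u').
      pose proof (ole_oadd_l (m [+] u') (m [+] v')). pose proof (ole_oadd_l m u').
      split; intro E; rewrite E in *; ord.
    (* Two high points would sum to a remainder at least [x], and at least [m] for the images, but
       remainders in [B] are below [m]. *)
    + rewrite !oadd_assoc. destruct (Hhi w' Hw) as [Hw' _].
      pose proof (ole_oadd_r u' (x [+] v')). pose proof (ole_oadd_l x v').
      pose proof (ole_oadd_r u' (m [+] v')). pose proof (ole_oadd_l m v').
      split; intro E; apply oadd_cancel in E; rewrite E in *; ord.
Qed.

(** Induction on [t]: the high points of a finite set have remainders at most some [b << t], so the
    induction hypothesis supplies the [<_1]-relations that [shift_reflects] needs at [d] and at the
    new exponent. *)
Lemma mult_le1 t d : mult t d -> t <<= oexp d -> le1 (oexp d) (oexp d [+] t).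
Proof.
  revert d. induction t as [t IH] using (well_founded_ind (@olt_wf T)). intros d Hm Ht.
  destruct (classic (t = ozero)) as [->|Ht0]; [right; now rewrite oadd_0_r|left].
  apply lt1_unfold. split; [now apply olt_oadd|]. intros B HB.
  destruct Hm as [Hd0 Hd].
  destruct (@list_bound T (fun y m => y <<= m) B (oexp d) (oexp d [+] t))
    as (m1 & Hm1 & Hx & HmB).
  { intros; ord. }
  { now apply olt_oadd. }
  { intros z Hz; exists z; auto using ole_refl. }
  destruct (oadd_sub Hx) as [b <-]. apply oadd_lt_inv in Hm1.
  assert (Hb : forall w, In (oexp d [+] w) B -> w <<= b).
  { intros w Hw. apply HmB in Hw. apply not_olt; intro L.
    apply (oadd_mono T (oexp d)) in L. ord. }
  (* [m] dominates [b], all low points, and their thresholds from [lt1_limit]. *)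
  destruct (@list_bound T (fun u m => u << oexp d ->
      u <<= m /\ forall c, m <<= c -> lt1 u c -> lt1 u (oexp d)) B b (oexp d))
    as (m & Hm & Hbm & Hlo).
  { intros u m m' H Hmm Hu. destruct (H Hu) as [H1 H2]. split; [ord|].
    intros c Hc. apply H2. ord. }
  { ord. }
  { intros u Hu. destruct (olt_or_ge u (oexp d)) as [L|L].
    - destruct (lt1_limit Hd0 L) as (m & Hm & Hl).
      destruct (olt_or_ge u m) as [H|H].
      + exists m; split; auto. split; [ord|auto].
      + exists u; split; auto. split; [ord|]. intros c Hc. apply Hl. ord.
    - exists b. split; [ord|]. intro. exfalso. ord. }
  assert (Hz : exists z, z << d /\ m << oexp (osucc z)).
  { destruct (classic (m = ozero)) as [->|Hm0].
    - exists ozero. split; [now apply ozero_olt|]. apply ozero_olt, oexp_neq_ozero.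
    - destruct (log_ex Hm0) as (z & Hz1 & Hz2). exists z; split; auto.
      apply oexp_lt_inv. ord. }
  destruct Hz as (z & Hzd & Hmz).
  (* The summand [oexp b] makes [d'] a multiple of [oexp b], and [z] lifts [oexp d'] above [m].
     Since [d] is a multiple of [oexp t], [d' << z [+] oexp t <<= d]. *)
  set (d' := z [+] oexp b).
  assert (Hd' : d' << d).
  { specialize (Hd z Hzd). pose proof (oexp_mono T _ _ Hm1) as L.
    apply (oadd_mono T z) in L. unfold d'. ord. }
  assert (Hmd : m << oexp d').
  { apply olt_ole_trans with (oexp (osucc z)); auto.
    apply oexp_ole, oadd_ole, oexp_ole, ozero_ole. }
  apply (shift_reflects Hd').
  - intros u Hu Lu. destruct (Hlo u Hu Lu) as [H1 H2]. split; [ord|].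
    apply H2. now left.
  - intros w Hw. apply Hb in Hw. split; [ord|]. split.
    + apply IH; [ord| |ord]. apply mult_ole with b; auto. apply mult_add.
    + apply IH; [ord| |ord]. apply mult_ole with t; [ord|]. now split.
Qed.

(** Let [d = c [+] oexp W] and suppose [W << V]. Reflection yields [oexp k << oexp d] with [c << k]
    and [oexp k <_1 oexp k [+] W]; by induction [k] is a multiple of [oexp W], whence [d = c [+]
    oexp W <<= k]. *)
Lemma lt1_mult V d : V <<= oexp d -> lt1 (oexp d) (oexp d [+] V) -> mult V d.
Proof.
  revert d. induction V as [V IH] using (well_founded_ind (@olt_wf T)). intros d HV H1.
  assert (Hd0 : d <> ozero).
  { destruct (lt1_principal H1) as (d' & E & Hd'). apply oexp_inj in E. now subst. }
  destruct (last_term_ex Hd0) as (c & W & Ed & HW).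
  destruct (olt_or_ge W V) as [HWV|HWV].
  2: { apply mult_ole with W; auto. now apply multI_mult. }
  exfalso. pose proof (lt1_olt H1) as HxV.
  assert (HxW : oexp d [+] W << oexp d [+] V) by now apply oadd_mono.
  assert (Hc : oexp c << oexp d).
  { apply oexp_mono. rewrite Ed. apply olt_oadd, oexp_neq_ozero. }
  pose proof (proj1 (lt1_unfold _ _) H1) as [_ HB].
  destruct (HB [oexp c; W; oexp d; oexp d [+] W]) as (h & R1 & R2 & R3 & R4 & R5).
  { intros x [<-|[<-|[<-|[<-|[]]]]]; auto; ord. }
  set (B := [oexp c; W; oexp d; oexp d [+] W]) in *.
  assert (I1 : In (oexp c) B) by (simpl; auto).
  assert (I2 : In W B) by (simpl; auto).
  assert (I3 : In (oexp d) B) by (simpl; auto).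
  assert (I4 : In (oexp d [+] W) B) by (simpl; auto).
  assert (Ec : h (oexp c) = oexp c) by (apply R2; auto).
  assert (EW : h W = W) by (apply R2; auto; ord).
  assert (Hcm : oexp c << h (oexp d)) by (rewrite <- Ec; apply (R3 (oexp c) (oexp d)); auto).
  assert (HWm : W << h (oexp d)) by (rewrite <- EW at 1; apply (R3 W (oexp d)); auto; ord).
  assert (Hm : h (oexp d) << oexp d) by auto.
  destruct (classic (W = ozero)) as [HW0|HW0].
  (* For [W = ozero] the last two points coincide; the preserved absorption of [oexp c] bounds the
     image below by [oexp (osucc c) = oexp d]. *)
  - assert (E : oexp c [+] oexp d = oexp d) by now apply absorb.
    apply R5 in E; auto. rewrite Ec in E.
    apply absorbing_ge with (c := c) in E; [|apply ole_refl].
    unfold osucc, oone in E. rewrite <- HW0, <- Ed in E. ord.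
  - assert (L : lt1 (oexp d) (oexp d [+] W)).
    { apply lt1_ole_right with (oexp d [+] V); auto; [now apply olt_oadd|now left]. }
    apply R4 in L; auto.
    rewrite <- (proj1 (R5 (oexp d) W _ I3 I2 I4) eq_refl), EW in L.
    destruct (lt1_principal L) as (k & Ek & _). rewrite Ek in *.
    apply IH in L; auto; [|now left]. destruct L as [_ L].
    apply oexp_lt_inv in Hcm. apply L in Hcm. rewrite <- Ed in Hcm.
    apply oexp_ole in Hcm. ord.
Qed.

Lemma eps_lt1_double a : is_eps a -> lt1 a (a [+] a).
Proof.
  intro Ha. destruct (@mult_le1 a a) as [H|H].
  - apply multI_mult. assert (H : multI a (oexp a)) by (constructor; apply ole_refl).
    now rewrite Ha in H.
  - apply ole_oexp.
  - now rewrite Ha in H.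
  - rewrite Ha in H. exfalso. pose proof (olt_oadd a (eps_pos Ha)) as L.
    rewrite <- H in L. ord.
Qed.

(** For [a = oexp d], being a multiple of [oexp (oexp d)] forces [oexp (oexp d) <<= d]. *)
Lemma lt1_double_eps a : lt1 a (a [+] a) -> is_eps a.
Proof.
  intro H. destruct (lt1_principal H) as (d & -> & Hd).
  apply lt1_mult in H; [|apply ole_refl]. destruct H as [_ H].
  specialize (H ozero (ozero_olt Hd)). rewrite oadd_0_l in H.
  unfold is_eps. pose proof (ole_oexp d). pose proof (ole_oexp (oexp d)).
  apply ole_antisym; ord.
Qed.

(** Beyond [oexp c [+] W], [lt1_mult] would make [c] a multiple of [oexp (osucc W)], but [c] is less
    than [c0 [+] oexp (osucc W)]. The right-hand side mentions no [<_1] and so transfers along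
    substitutions. *)
Lemma lt1_noneps_principal c c0 W y : c = c0 [+] oexp W -> multI W c -> c << oexp c ->
  (lt1 (oexp c) y <-> oexp c << y /\ y <<= oexp c [+] W).
Proof.
  intros E HW Hc.
  assert (HWc : W << oexp c).
  { pose proof (ole_oadd_r c0 (oexp W)). rewrite <- E in *. pose proof (ole_oexp W). ord. }
  split.
  - intro H. split; [now apply lt1_olt|]. apply not_olt; intro L.
    assert (L' : osucc (oexp c [+] W) <<= y) by now apply osucc_ole.
    unfold osucc in L'. rewrite oadd_assoc in L'. fold (osucc W) in L'.
    assert (H' : lt1 (oexp c) (oexp c [+] osucc W)).
    { apply lt1_ole_right with y; auto. apply olt_oadd.
      intro E'. pose proof (olt_osucc W). rewrite E' in *. ord. }
    apply lt1_mult in H'; [|now apply osucc_ole]. destruct H' as [_ H'].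
    assert (Hc0 : c0 << c) by (rewrite E; apply olt_oadd, oexp_neq_ozero).
    apply H' in Hc0. rewrite E in Hc0.
    pose proof (oadd_mono T c0 _ _ (oexp_mono T _ _ (olt_osucc W))). ord.
  - intros [H1 H2]. destruct (mult_le1 (multI_mult HW) (olt_ole HWc)) as [H|H].
    + now apply lt1_ole_right with (oexp c [+] W).
    + rewrite <- H in H2. ord.
Qed.

End LtOne.

(** * Replacing an epsilon number *)

Section Lift.
Context {T : OrdStr} (e alpha : T).
Context (He : is_eps e) (Ha : is_eps alpha) (Hea : e << alpha).
Implicit Types (x y z u v a b c d V W : T) (s t : list (T * nat)).

(** The segment below the next epsilon number after [e]; quantifying over all candidates makes the
    closure properties pointwise. *)
Definition dom y := forall e', is_eps e' -> e << e' -> y << e'.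

Lemma dom_ole x y : x <<= y -> dom y -> dom x.
Proof. intros H Hy e' He' L. specialize (Hy e' He' L). ord. Qed.

Lemma dom_e : dom e.
Proof. intros e' _ L; exact L. Qed.

Lemma dom_lt x : x << e -> dom x.
Proof. intro H. apply dom_ole with e; auto using dom_e, olt_ole. Qed.

Lemma dom_0 : dom ozero.
Proof. apply dom_lt, ozero_olt, eps_pos, He. Qed.

Lemma dom_add x y : dom x -> dom y -> dom (x [+] y).
Proof. intros Hx Hy e' He' L. apply eps_add_lt; auto. Qed.

Lemma dom_exp x : dom x -> dom (oexp x).
Proof. intros Hx e' He' L. apply eps_oexp_lt; auto. Qed.

Lemma dom_exp_inv x : dom (oexp x) -> dom x.
Proof. apply dom_ole, ole_oexp. Qed.

Lemma dom_noneps y : dom y -> e << y -> ~ is_eps y.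
Proof. intros Hy L E. specialize (Hy y E L). ord. Qed.

(* [lift y] is [y] with [e] replaced by [alpha], for [y] below the next epsilon number:
   the inverse of the substitution [alpha := e], but defined on an initial segment. *)
Inductive lift_rel : T -> T -> Prop :=
| lift_rel_lt y : y << e -> lift_rel y y
| lift_rel_e : lift_rel e alpha
| lift_rel_lead c b u v : e << oexp c [+] b -> b << oexp (osucc c) ->
    lift_rel c u -> lift_rel b v -> lift_rel (oexp c [+] b) (oexp u [+] v).

Lemma lift_rel_fun y x x' : lift_rel y x -> lift_rel y x' -> x = x'.
Proof.
  intro H. revert x'.
  induction H as [y H| |c b u v H Hb Hc IHc Hb' IHb]; intros x' H'.
  - inversion H'; subst; auto; exfalso; ord.
  - inversion H' as [y L| |c b u v L Hb Hc Hb' E]; subst; auto; exfalso; [ord|].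
    rewrite E in L. ord.
  - inversion H' as [y' L|E|c' b' u' v' L Lb Lc Lb' E]; subst.
    + exfalso; ord.
    + exfalso. rewrite <- E in H. ord.
    + destruct (lead_unique Lb Hb E) as [-> ->].
      rewrite (IHc u'), (IHb v'); auto.
Qed.

Lemma lift_rel_ex y : dom y -> exists x, lift_rel y x.
Proof.
  induction y as [y IH] using (well_founded_ind (@olt_wf T)). intro Hy.
  destruct (olt_total T y e) as [L|[->|L]].
  - exists y. now constructor.
  - exists alpha. constructor.
  - destruct (lead_ex (olt_neq_ozero L)) as (c & b & E & Hb & Hby).
    (* Otherwise [y] would be an epsilon number above [e]. *)
    assert (Hcy : c << y).
    { pose proof (ole_oexp c) as H. pose proof (ole_oadd_l (oexp c) b). rewrite <- E in *.
      destruct (ole_trans H H0) as [H1|H1]; auto. exfalso. subst c.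
      apply (dom_noneps Hy L). now apply ole_antisym. }
    destruct (IH c Hcy) as [u Hu]; [apply dom_ole with y; auto; ord|].
    destruct (IH b Hby) as [v Hv]; [apply dom_ole with y; auto; ord|].
    exists (oexp u [+] v). rewrite E in L |- *. now constructor.
Qed.

Definition lift y : T := epsilon (inhabits ozero) (lift_rel y).

Lemma liftP y : dom y -> lift_rel y (lift y).
Proof. intro H. exact (epsilon_spec (inhabits ozero) (lift_rel y) (lift_rel_ex H)). Qed.

Lemma lift_lt y : y << e -> lift y = y.
Proof.
  intro H. eapply lift_rel_fun; [apply liftP, dom_lt, H|now constructor].
Qed.

Lemma lift_0 : lift ozero = ozero.
Proof. apply lift_lt, ozero_olt, eps_pos, He. Qed.

Lemma lift_e : lift e = alpha.
Proof. eapply lift_rel_fun; [apply liftP, dom_e|constructor]. Qed.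

(** Extends the clause [lift_rel_lead] to all of [dom]: below [e] every part is fixed, and [e] is
    [oexp e [+] ozero], where [alpha] being an epsilon number gives the equation. *)
Lemma lift_lead c b : dom (oexp c [+] b) -> b << oexp (osucc c) ->
  lift (oexp c [+] b) = oexp (lift c) [+] lift b.
Proof.
  intros Hy Hb. pose proof (ole_oadd_l (oexp c) b). pose proof (ole_oadd_r (oexp c) b).
  pose proof (ole_oexp c).
  destruct (olt_total T (oexp c [+] b) e) as [L|[L|L]].
  - rewrite !lift_lt; auto; ord.
  - assert (E : oexp c [+] b = oexp e [+] ozero) by now rewrite oadd_0_r, L, He.
    destruct (lead_unique Hb (ozero_olt (@oexp_neq_ozero _ _)) E) as [-> ->].
    now rewrite oadd_0_r, lift_0, oadd_0_r, He, lift_e, Ha.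
  - eapply lift_rel_fun; [apply liftP, Hy|].
    apply lift_rel_lead; auto; apply liftP; apply dom_ole with (oexp c [+] b); auto; ord.
Qed.

(** Comparison of leading terms, by an outer induction on the larger argument and an inner one on
    the smaller. *)
Lemma lift_mono y y' : dom y' -> y << y' -> lift y << lift y'.
Proof.
  revert y. induction y' as [y' IH'] using (well_founded_ind (@olt_wf T)).
  intros y. induction y as [y IH] using (well_founded_ind (@olt_wf T)). intros Hy' Hyy.
  assert (Hy : dom y) by (apply dom_ole with y'; auto using olt_ole).
  destruct (olt_total T y' e) as [L|[->|L]].
  { rewrite !lift_lt; auto; ord. }
  { rewrite lift_e, lift_lt; auto; ord. }
  destruct (lead_ex (olt_neq_ozero L)) as (c' & b' & E' & Hb' & Hby').
  pose proof (ole_oadd_l (oexp c') b') as Hc'. rewrite <- E' in Hc'.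
  pose proof (ole_oexp c') as Hcc'.
  assert (Hcy' : c' << y').
  { destruct (ole_trans Hcc' Hc') as [H1|H1]; auto. exfalso. subst c'.
    apply (dom_noneps Hy' L). now apply ole_antisym. }
  assert (El' : lift y' = oexp (lift c') [+] lift b').
  { rewrite E' in Hy' |- *. now apply lift_lead. }
  pose proof (ole_oadd_l (oexp (lift c')) (lift b')) as Hl. rewrite <- El' in Hl.
  destruct (classic (y = ozero)) as [->|Hy0].
  { rewrite lift_0. eapply olt_ole_trans; [apply ozero_olt, oexp_neq_ozero|exact Hl]. }
  destruct (lead_ex Hy0) as (c & b & E & Hb & Hby).
  assert (El : lift y = oexp (lift c) [+] lift b).
  { rewrite E in Hy |- *. now apply lift_lead. }
  assert (Hc : c <<= c').
  { apply (@lead_log_ole _ c b c' b'); auto. rewrite <- E, <- E'. now left. }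
  destruct Hc as [Hc| ->].
  - apply olt_ole_trans with (oexp (lift c')); auto.
    rewrite El. apply oexp_add_lt.
    + apply oexp_mono. apply IH'; auto. apply dom_ole with y'; auto using olt_ole.
    + pose proof (oexp_ole (osucc_ole Hc)) as H1.
      (* The remainder [b] is below [oexp c']: the outer hypothesis applies if [oexp c' << y'], the
         inner one if [y' = oexp c']. *)
      destruct Hc' as [Hc'|Hc'].
      * assert (Hd : dom (oexp c')) by (apply dom_ole with y'; auto using olt_ole).
        assert (El'' : lift (oexp c') = oexp (lift c')).
        { rewrite <- (oadd_0_r (oexp c')), lift_lead, lift_0, oadd_0_r; auto.
          - now rewrite oadd_0_r.
          - apply ozero_olt, oexp_neq_ozero. }
        rewrite <- El''. apply IH'; auto. ord.
      * assert (b' = ozero) as ->.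
        { apply (@oadd_cancel _ (oexp c')). now rewrite <- E', oadd_0_r. }
        rewrite lift_0, oadd_0_r in El'. rewrite <- El'. apply IH; auto. ord.
  - rewrite El, El'. apply oadd_mono, IH'; auto.
    + apply dom_ole with y'; auto using olt_ole.
    + apply (@oadd_lt_inv _ (oexp c')). now rewrite <- E, <- E'.
Qed.

Lemma lift_ole y y' : dom y' -> y <<= y' -> lift y <<= lift y'.
Proof. intros Hd [H| ->]; [left; now apply lift_mono|apply ole_refl]. Qed.

Lemma lift_lt_inv y y' : dom y -> lift y << lift y' -> y << y'.
Proof.
  intros Hy H. destruct (olt_or_ge y y') as [|L]; auto. exfalso.
  apply (lift_ole Hy) in L. ord.
Qed.

Lemma lift_inj y y' : dom y -> dom y' -> lift y = lift y' -> y = y'.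
Proof.
  intros Hy Hy' E. destruct (olt_total T y y') as [H|[H|H]]; auto; exfalso;
    apply lift_mono in H; auto; rewrite E in H; ord.
Qed.

Lemma lift_exp c : dom c -> lift (oexp c) = oexp (lift c).
Proof.
  intro Hc. rewrite <- (oadd_0_r (oexp c)), lift_lead, lift_0, oadd_0_r; auto.
  - rewrite oadd_0_r. now apply dom_exp.
  - apply ozero_olt, oexp_neq_ozero.
Qed.

(** Either the leading term of [a] survives in the sum and induction handles the remainder, or the
    leading term of [b] absorbs [a], before and after lifting. *)
Lemma lift_add a b : dom a -> dom b -> lift (a [+] b) = lift a [+] lift b.
Proof.
  induction a as [a IH] using (well_founded_ind (@olt_wf T)). intros Hda Hdb.
  destruct (classic (a = ozero)) as [->|Ha0]; [now rewrite lift_0, !oadd_0_l|].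
  destruct (lead_ex Ha0) as (c & a' & E & Ha' & Haa').
  destruct (olt_or_ge b (oexp (osucc c))) as [L|L].
  - assert (Hs : a' [+] b << oexp (osucc c)) by now apply oexp_add_lt.
    rewrite E, oadd_assoc, !lift_lead; auto.
    + rewrite oadd_assoc. f_equal. apply IH; auto. apply dom_ole with a; auto using olt_ole.
    + now rewrite <- E.
    + rewrite <- oadd_assoc, <- E. now apply dom_add.
  - assert (Hb0 : b <> ozero).
    { apply olt_neq_ozero with ozero. eapply olt_ole_trans; [|exact L].
      apply ozero_olt, oexp_neq_ozero. }
    destruct (lead_ex Hb0) as (d & b' & Eb & Hb' & _).
    assert (Hcd : osucc c <<= d).
    { apply (@lead_log_ole _ (osucc c) ozero d b'); auto. now rewrite oadd_0_r, <- Eb. }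
    assert (Had : a << oexp d).
    { apply olt_ole_trans with (oexp (osucc c)); [|now apply oexp_ole].
      rewrite E. now apply lead_lt. }
    assert (Hdd : dom (oexp d)).
    { apply dom_ole with b; auto. rewrite Eb. apply ole_oadd_l. }
    assert (Hl : lift a << oexp (lift d)).
    { rewrite <- lift_exp; auto using dom_exp_inv. now apply lift_mono. }
    assert (El : lift b = oexp (lift d) [+] lift b').
    { rewrite Eb in Hdb |- *. now apply lift_lead. }
    rewrite El, <- oadd_assoc, (absorb Hl), <- El.
    now rewrite Eb, <- oadd_assoc, (absorb Had).
Qed.

Lemma lift_natmul (L : T) n : dom L -> lift (natmul L n) = natmul (lift L) n.
Proof.
  intro HL. assert (Hn : forall n, dom (natmul L n)).
  { clear n. induction n; simpl; auto using dom_0, dom_add. }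
  induction n as [|n IH]; simpl; [apply lift_0|]. rewrite lift_add; auto. now rewrite IH.
Qed.

Lemma lift_isP (L : T) : dom L -> isP L -> isP (lift L).
Proof.
  intros Hd HP. destruct (isP_ex HP) as [c ->].
  rewrite lift_exp; auto using dom_exp_inv. apply isP_oexp.
Qed.

Lemma dom_natmul_inv (L : T) n : 0 < n -> dom (natmul L n) -> dom L.
Proof. intros Hn. apply dom_ole. rewrite <- (natmul_1 L) at 1. now apply natmul_ole. Qed.

Lemma lift_cnf y s : dom y -> is_cnf y s ->
  is_cnf (lift y) (map (fun p => (lift (fst p), snd p)) s).
Proof.
  revert y. induction s as [|[L n] s IH]; intros y Hd Hy; simpl.
  - destruct Hy as (_ & _ & ->). simpl. rewrite lift_0. apply is_cnf_nil.
  - destruct (is_cnf_inv Hy) as (HL & Hn & Hs & HsL & ->).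
    assert (Hd1 : dom (natmul L n)) by (eapply dom_ole; [apply ole_oadd_l|exact Hd]).
    assert (Hd2 : dom (cnfsum s)) by (eapply dom_ole; [apply ole_oadd_r|exact Hd]).
    assert (Hd3 : dom L) by eauto using dom_natmul_inv.
    rewrite lift_add, lift_natmul; auto. apply is_cnf_cons; auto using lift_isP.
    intros q Hq. apply in_map_iff in Hq. destruct Hq as ([M m] & <- & Hq).
    apply lift_mono; [exact Hd3|exact (HsL _ Hq)].
Qed.

Lemma lift_multI V d : dom d -> multI V d -> multI (lift V) (lift d).
Proof.
  intros Hd H. induction H as [W H|a b H1 IH1 H2 IH2].
  - rewrite lift_exp; auto using dom_exp_inv. constructor. apply lift_ole; auto using dom_exp_inv.
  - assert (dom a) by (eapply dom_ole; [apply ole_oadd_l|exact Hd]).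
    assert (dom b) by (eapply dom_ole; [apply ole_oadd_r|exact Hd]).
    rewrite lift_add; auto. now apply multI_add; auto.
Qed.

Lemma lift_isP_inv y : dom y -> isP (lift y) -> isP y.
Proof.
  intros Hy [H0 HP].
  assert (Hy0 : y <> ozero) by (intros ->; apply H0, lift_0).
  apply NNPP; intro Hn. destruct (not_isP_sum Hy0 Hn) as (a & b & Hay & Hby & E).
  pose proof (HP _ _ (lift_mono Hy Hay) (lift_mono Hy Hby)) as L.
  rewrite <- lift_add, E in L; [ord| |]; apply dom_ole with y; auto using olt_ole.
Qed.

Lemma lift_exp_inv y u : dom y -> lift y = oexp u ->
  exists c, y = oexp c /\ dom c /\ lift c = u.
Proof.
  intros Hy E. destruct (@isP_ex _ y) as [c ->].
  - apply lift_isP_inv; auto. rewrite E. apply isP_oexp.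
  - exists c. apply dom_exp_inv in Hy. rewrite lift_exp in E; auto.
    repeat split; auto. now apply oexp_inj.
Qed.

Lemma lift_lt_alpha y : dom y -> lift y << alpha -> y << e.
Proof. intros Hy H. rewrite <- lift_e in H. eapply lift_lt_inv; eauto. Qed.

Lemma lift_noneps y : dom y -> e << y -> ~ is_eps (lift y).
Proof.
  intros Hy L E. unfold is_eps in E. symmetry in E.
  destruct (lift_exp_inv Hy E) as (c & -> & Hc & Ec). apply lift_inj in Ec; auto.
  apply (dom_noneps Hy L). unfold is_eps. f_equal. now symmetry.
Qed.

(** All parts of [lift y] visited by [InEp] are lifts of parts of [y], and a lift below [alpha]
    comes from below [e]. *)
Lemma lift_Ep y e' : dom y -> InEp e' (lift y) -> e' << alpha -> e' << e.
Proof.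
  intros Hy H. remember (lift y) as x eqn:E. revert y Hy E.
  induction H as [x Hx|x s L l e' Hx Hs Hnt Hin H IH|x L e' Hx Ex H IH]; intros y Hy E La.
  - subst x. pose proof (lift_lt_alpha Hy La). now rewrite lift_lt.
  - destruct (cnf_ex y) as [s' Hs'].
    assert (Es : s = map (fun p => (lift (fst p), snd p)) s').
    { apply cnf_unique with x; auto. rewrite E. now apply lift_cnf. }
    rewrite Es in Hin. apply in_map_iff in Hin. destruct Hin as ([L' l'] & EL & Hin).
    injection EL as EL _. destruct (cnf_term Hs' Hin) as (_ & _ & Hle).
    apply IH with L'; auto. now apply dom_ole with y.
  - rewrite Ex in E. symmetry in E. apply lift_exp_inv in E; auto.
    destruct E as (c & _ & Hc & Ec). now apply IH with c.
Qed.

Lemma combine_map_split s : combine (map fst s) (map snd s) = s.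
Proof. induction s as [|[L l] s IH]; simpl; congruence. Qed.

(** The normal form of [lift y] is the lifted normal form of [y], so the clauses of [Subst] can be
    followed by induction on [y]. *)
Lemma lift_Subst y : dom y -> Subst alpha e (lift y) y.
Proof.
  induction y as [y IH] using (well_founded_ind (@olt_wf T)). intro Hy.
  destruct (classic (y = e)) as [->|Hye]; [rewrite lift_e; apply Sub_alpha|].
  destruct (classic (is_eps (lift y))) as [Eps|Eps].
  { destruct (olt_total T y e) as [L|[L|L]]; [|tauto|destruct (lift_noneps Hy L Eps)].
    rewrite lift_lt in Eps |- * by assumption. apply Sub_other; auto. intros ->. ord. }
  destruct (classic (y = ozero)) as [->|Hy0]; [rewrite lift_0; apply Sub_zero|].
  destruct (classic (isP y)) as [HP|HP].
  - destruct (isP_ex HP) as [c ->]. pose proof (dom_exp_inv Hy) as Hc.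
    rewrite lift_exp in Eps |- * by assumption.
    apply Sub_exp with (lift c); auto. apply IH; auto.
    apply oexp_gt. intro E. apply Eps. unfold is_eps in *. f_equal.
    now rewrite <- (lift_exp Hc), E.
  - destruct (cnf_ex y) as [s Hs]. pose proof (lift_cnf Hy Hs) as Hl.
    set (s' := map (fun p => (lift (fst p), snd p)) s) in *.
    assert (E : y = cnfsum (combine (map fst s) (map snd s'))).
    { unfold s'. rewrite map_map. simpl. rewrite combine_map_split. apply Hs. }
    rewrite E at 2. apply Sub_sum; auto.
    (* A single term with coefficient one would make [y] principal. *)
    + destruct s as [|[L l] [|p s]]; [|destruct l as [|[|l]]|].
      * destruct Hy0. apply Hs.
      * destruct Hs as (HF & _). inversion HF as [|? ? [_ H0]]. simpl in H0. lia.
      * destruct (is_cnf_inv Hs) as (HL & _ & _ & _ & Ey). simpl in Ey.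
        rewrite oadd_0_r, oadd_0_l in Ey. congruence.
      * right. exists (lift L), (S (S l)). split; [reflexivity|lia].
      * left. simpl. lia.
    + unfold s'. now rewrite !length_map.
    + intros i Hi. unfold s' in *. rewrite length_map in Hi.
      rewrite (nth_indep _ _ (lift ozero, 0)) by now rewrite length_map.
      rewrite (map_nth (fun p => (lift (fst p), snd p)) s (ozero, 0)).
      change (nth i (map fst s) ozero) with (nth i (map fst s) (fst (@ozero T, 0))).
      rewrite map_nth. simpl.
      assert (Hin : In (nth i s (ozero, 0)) s) by now apply nth_In.
      destruct (nth i s (ozero, 0)) as [L l] eqn:EL. simpl.
      destruct (cnf_term Hs Hin) as (HL & _ & Hle).
      apply IH; [|now apply dom_ole with y].
      apply ole_neq_olt; auto. intros ->. tauto.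
Qed.

(** * Lower bounds for isomorphisms on cover sets *)

Context (D : T -> Prop) (h : T -> T).
Context (HDa : D alpha) (Hiso : iso_lt_lt1_add D h)
  (Hfix : forall x, D x -> x << alpha -> h x = x) (Eh : h alpha = e).

(** By [lift_Subst] the witness [y] is [x[alpha := e]], so this is the estimate of part (a); naming
    it as a preimage under [lift] makes its closure under addition immediate. *)
Definition subst_le x := D x /\ exists y, dom y /\ lift y = x /\ y <<= h x.

Lemma h_lt x y : D x -> D y -> x << y -> h x << h y.
Proof. intros Hx Hy. apply Hiso; auto. Qed.

Lemma h_ole x y : D x -> D y -> x <<= y -> h x <<= h y.
Proof. intros Hx Hy [H| ->]; [left; now apply h_lt|apply ole_refl]. Qed.

Lemma h_add x y : D x -> D y -> D (x [+] y) -> h (x [+] y) = h x [+] h y.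
Proof.
  intros Hx Hy Hxy. destruct Hiso as (_ & _ & _ & H). symmetry. now apply (H x y (x [+] y)).
Qed.

Lemma h_lt1 x y : D x -> D y -> (lt1 x y <-> lt1 (h x) (h y)).
Proof. intros Hx Hy. now apply Hiso. Qed.

Lemma subst_le_lt x : D x -> x << alpha -> subst_le x.
Proof.
  intros Hx Hl. pose proof (h_lt Hx HDa Hl) as H. rewrite (Hfix Hx Hl), Eh in H.
  split; auto. exists x. rewrite (Hfix Hx Hl). auto using dom_lt, lift_lt, ole_refl.
Qed.

Lemma subst_le_alpha : subst_le alpha.
Proof.
  split; auto. exists e. rewrite Eh. auto using dom_e, lift_e, ole_refl.
Qed.

Lemma subst_le_add x y : subst_le x -> subst_le y -> D (x [+] y) -> subst_le (x [+] y).
Proof.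
  intros (Hx & x' & Dx & <- & Lx) (Hy & y' & Dy & <- & Ly) Hxy. split; auto.
  exists (x' [+] y'). rewrite h_add; auto.
  split; [|split]; auto using dom_add, lift_add, oadd_ole_mono.
Qed.

(* The lower bound for [h]: [X := oexp (prev + oexp V)] satisfies [X <_1 X + V], hence
   [h X <_1 h X + h V], which forces the exponent of [h X] to be a multiple of
   [oexp (h V)] above the exponent of [h (oexp prev)]. *)
Lemma subst_le_step prev V : let X := oexp (prev [+] oexp V) in
  multI V (prev [+] oexp V) -> D X ->
  (V = ozero \/ subst_le V /\ D (X [+] V)) -> (prev = ozero \/ subst_le (oexp prev)) -> subst_le X.
Proof.
  intros X HM HX HV Hprev.
  destruct (olt_or_ge X alpha) as [L|L]; [now apply subst_le_lt|].
  (* [p] is [prev] with [alpha] replaced; it lies below the exponent of [h X] because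
     [oexp p <<= h (oexp prev) << h X]. *)
  assert (Hp : exists p, dom p /\ lift p = prev /\
    forall k, k <> ozero -> h X = oexp k -> p << k).
  { destruct Hprev as [->|(Hd & q & Dq & Eq & Lq)].
    - exists ozero. split; [apply dom_0|split; [apply lift_0|]].
      intros k Hk _. now apply ozero_olt.
    - destruct (lift_exp_inv Dq Eq) as (p & -> & Dp & Ep). exists p.
      split; [|split]; auto. intros k _ Ek. apply oexp_lt_inv. rewrite <- Ek.
      apply ole_olt_trans with (h (oexp prev)); auto. apply h_lt; auto.
      apply oexp_mono, olt_oadd, oexp_neq_ozero. }
  destruct Hp as (p & Dp & Ep & Hpk).
  assert (Hv : V = ozero \/ V <> ozero /\ subst_le V /\ D (X [+] V)).
  { destruct (classic (V = ozero)); tauto. }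
  clear HV. destruct Hv as [->|(HV0 & (HV & v & Dv & Ev & Lv) & HXV)].
  - split; auto. exists (oexp (p [+] oexp ozero)).
    assert (D0 := dom_0). split; [auto using dom_exp, dom_add|].
    split; [rewrite lift_exp, lift_add, lift_exp, lift_0, Ep; auto using dom_exp, dom_add|].
    destruct Hprev as [->|(Hd & q & Dq & Eq & Lq)].
    (* Here [X = oexp (oexp ozero)], which is below any epsilon number. *)
    + exfalso. assert (X << alpha); [|ord]. unfold X. rewrite oadd_0_l.
      do 2 (apply eps_oexp_lt; [exact Ha|]).
      apply ozero_olt, eps_pos, Ha.
    + destruct (lift_exp_inv Dq Eq) as (p' & -> & Dp' & Ep').
      assert (p' = p) as -> by (apply lift_inj; auto; congruence).
      (* For [V = ozero] there is no [<_1]-relation to use; [h] preserves the absorption of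
         [oexp prev] by [X] instead. *)
      apply absorbing_ge with (h (oexp prev)); auto.
      assert (E : oexp prev [+] X = X).
      { apply absorb, oexp_mono, olt_oadd, oexp_neq_ozero. }
      rewrite <- h_add, E; auto. now rewrite E.
  - assert (HVX : V <<= X).
    { unfold X. pose proof (ole_oexp V). pose proof (ole_oadd_r prev (oexp V)).
      pose proof (ole_oexp (prev [+] oexp V)). ord. }
    destruct (mult_le1 (multI_mult HM) HVX) as [H1|H1].
    2: { exfalso. fold X in H1. pose proof (olt_oadd X HV0) as H2. rewrite <- H1 in H2. ord. }
    apply h_lt1 in H1; auto. fold X in H1. rewrite h_add in H1; auto.
    destruct (lt1_principal H1) as (k & Ek & Hk). rewrite Ek in H1.
    apply lt1_mult in H1; [|rewrite <- Ek; now apply h_ole].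
    specialize (Hpk k Hk Ek). apply H1 in Hpk.
    split; auto. exists (oexp (p [+] oexp v)). split; [auto using dom_exp, dom_add|].
    split; [rewrite lift_exp, lift_add, lift_exp, Ep, Ev; auto using dom_exp, dom_add|].
    rewrite Ek. apply oexp_ole. eapply ole_trans; [|exact Hpk].
    now apply oadd_ole, oexp_ole.
Qed.

(** All intermediate multiples and partial sums are in [InC2], hence in [D], so each point is
    reached by single additions inside [D]. *)
Lemma subst_le_C2 d s : is_cnf d s -> (forall L l, In (L, l) s -> subst_le L) ->
  (forall x, InC2 d x -> D x) -> forall x, InC2 d x -> subst_le x.
Proof.
  intros Hs HL HD.
  assert (Hmul : forall L l j, In (L, l) s -> 1 <= j <= l -> subst_le (natmul L j)).
  { intros L l j Hin. induction j as [|j IH]; intro Hj; [lia|].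
    destruct j as [|j]; [rewrite natmul_1; eauto|].
    change (subst_le (natmul L (S j) [+] L)). apply subst_le_add; [apply IH; lia|eauto|].
    apply HD. exists s; split; auto. left. now exists L, l, (S (S j)). }
  assert (Hsum : forall j, 1 <= j <= length s -> subst_le (cnfsum (firstn j s))).
  { induction j as [|j IH]; intro Hj; [lia|].
    assert (Hm : subst_le (natmul (fst (nth j s (ozero, 0))) (snd (nth j s (ozero, 0))))).
    { assert (Hin : In (nth j s (ozero, 0)) s) by (apply nth_In; lia).
      destruct (nth j s (ozero, 0)) as [L l]. apply Hmul with l; auto.
      destruct (cnf_term Hs Hin) as (_ & Hl & _). simpl. lia. }
    assert (HDj : D (cnfsum (firstn (S j) s))).
    { apply HD. exists s; split; auto. right. now exists (S j). }
    rewrite (@cnfsum_firstn_S _ s j (ozero, 0)) in HDj |- * by lia.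
    destruct j as [|j].
    - simpl in *. rewrite oadd_0_l. auto.
    - apply subst_le_add; auto. apply IH. lia. }
  intros x (s' & Hs' & Hx). rewrite (cnf_unique Hs' Hs) in Hx.
  destruct Hx as [(L & l & j & Hin & Hj & ->)|(j & Hj & ->)]; eauto.
Qed.

Lemma InC_self V : V <> ozero -> InC V V.
Proof.
  intro HV. apply C_2. destruct (cnf_ex V) as [s Hs]. exists s; split; auto. right.
  exists (length s). rewrite firstn_all. split; [|apply Hs].
  destruct s; simpl; [|lia]. destruct HV. apply Hs.
Qed.

Lemma InY_lt d V : InY d V -> V << d.
Proof.
  intros (s & L & l & Z & t & M & v & Hs & HL & HLe & -> & Ht & HM & EV).
  destruct (cnf_term Hs HL) as (_ & _ & H1). destruct (cnf_term Ht HM) as (_ & _ & H2).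
  pose proof (ole_oexp V). rewrite EV in *.
  assert (Z << oexp Z); [|ord]. apply oexp_gt. intro E. apply HLe.
  unfold is_eps in *. congruence.
Qed.

(** Induction on [d]: the exponents in [InY d] are smaller and their cover sets are contained in
    that of [d]. *)
Lemma subst_le_C ap d : next_eps alpha ap -> d << ap -> (forall x, InC d x -> D x) ->
  forall x, InC d x -> subst_le x.
Proof.
  intros Hap. induction d as [d IH] using (well_founded_ind (@olt_wf T)). intros Hd HD.
  assert (HYok : forall V, InY d V -> forall x, InC V x -> subst_le x).
  { intros V HV. pose proof (InY_lt HV). apply IH; auto; [ord|].
    intros x Hx. apply HD. eapply C_Y; eauto. }
  assert (HYV : forall V, InY d V -> V = ozero \/ subst_le V).
  { intros V HV. destruct (classic (V = ozero)); auto. right.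
    apply (HYok V HV). now apply InC_self. }
  assert (HF : forall s L l Z t k j, is_cnf d s -> In (L, l) s -> ~ is_eps L ->
    L <> oone -> L = oexp Z -> is_cnf Z t -> k < length t ->
    1 <= j <= snd (nth k t (ozero, 0)) ->
    exists V, oexp V = fst (nth k t (ozero, 0)) /\ InY d V /\
    let pre := cnfsum (firstn k t) [+] natmul (oexp V) j in
    multI V pre /\ subst_le (oexp pre) /\ (V = ozero \/ subst_le V /\ subst_le (oexp pre [+] V))).
  { intros s L l Z t k j Hs HL HLe HL1 EZ Ht.
    assert (Hstep : forall k j, k < length t -> S j <= snd (nth k t (ozero, 0)) ->
      let pre := fun j => cnfsum (firstn k t) [+] natmul (fst (nth k t (ozero, 0))) j in
      pre j = ozero \/ subst_le (oexp (pre j)) ->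
      exists V, oexp V = fst (nth k t (ozero, 0)) /\ InY d V /\
        multI V (pre (S j)) /\ subst_le (oexp (pre (S j))) /\
        (V = ozero \/ subst_le V /\ subst_le (oexp (pre (S j)) [+] V))).
    { clear k j. intros k j Hk Hj pre Hprev.
      assert (Hin : In (nth k t (ozero, 0)) t) by now apply nth_In.
      destruct (nth k t (ozero, 0)) as [M v] eqn:Ek. simpl in *.
      destruct (cnf_term Ht Hin) as (HMP & Hv & _).
      destruct (isP_ex HMP) as [V HV]. exists V.
      assert (Epre : pre (S j) = pre j [+] oexp V).
      { unfold pre. simpl. now rewrite <- HV, oadd_assoc. }
      assert (HY : InY d V) by (exists s, L, l, Z, t, M, v; auto 10).
      assert (HM : multI V (pre (S j))).
      { unfold pre. rewrite HV. apply (multI_firstn Ht Hk); [lia|]. now rewrite Ek. }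
      assert (HDF : forall x, x = oexp (pre (S j)) \/ x = oexp (pre (S j)) [+] V -> D x).
      { intros x Hx. apply HD, C_1. exists s, L, l. do 3 (split; [assumption|]).
        right. do 2 (split; [assumption|]). exists Z, t, k, (S j).
        do 3 (split; [assumption|]). rewrite Ek. split; [simpl; lia|].
        destruct Hx as [Hx|Hx]; [now left|]. right. exists V. auto. }
      assert (HX : D (oexp (pre (S j)))) by auto.
      assert (HXV : D (oexp (pre (S j)) [+] V)) by auto.
      assert (HokX : subst_le (oexp (pre (S j)))).
      { rewrite Epre in *. apply subst_le_step; auto.
        destruct (HYV V HY); auto. }
      do 4 (split; auto). destruct (HYV V HY); auto. right. split; auto. now apply subst_le_add. }
    (* Walks through the exponent one copy of a term at a time; zero copies of term [k + 1] means
       all copies of term [k]. *)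
    assert (Hall : forall k j, k < length t -> j <= snd (nth k t (ozero, 0)) ->
      let pre := cnfsum (firstn k t) [+] natmul (fst (nth k t (ozero, 0))) j in
      pre = ozero \/ subst_le (oexp pre)).
    { clear k j. induction k as [|k IHk]; intros j Hk; induction j as [|j IHj]; intros Hj pre.
      - left. apply oadd_0_l.
      - right. destruct (Hstep 0 j Hk Hj) as (V & _ & _ & _ & H & _); [|exact H].
        apply IHj. lia.
      - unfold pre. simpl natmul. rewrite oadd_0_r.
        rewrite (@cnfsum_firstn_S _ t k (ozero, 0)) by lia. apply IHk; lia.
      - right. destruct (Hstep (S k) j Hk Hj) as (V & _ & _ & _ & H & _); [|exact H].
        apply IHj. lia. }
    intros Hk Hj. destruct j as [|j]; [lia|].
    destruct (Hstep k j Hk (proj2 Hj)) as (V & EV & H); [apply Hall; lia|].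
    exists V. rewrite EV. tauto. }
  assert (HLok : forall s L l, is_cnf d s -> In (L, l) s -> subst_le L).
  { intros s L l Hs HL. destruct (cnf_term Hs HL) as (HP & Hl & Hle).
    assert (HDL : D L).
    { apply HD, C_2. exists s; split; auto. left. exists L, l, 1.
      rewrite natmul_1. repeat split; auto. }
    destruct (classic (is_eps L)) as [HLe|HLe].
    { destruct (olt_total T L alpha) as [H|[->|H]]; [now apply subst_le_lt|apply subst_le_alpha|].
      (* An epsilon number above [alpha] is at least [ap], but [L <<= d << ap]. *)
      destruct Hap as (_ & _ & Hmin). specialize (Hmin L HLe H). exfalso; ord. }
    destruct (classic (L = oone)) as [->|HL1].
    { apply subst_le_lt; auto. apply eps_oexp_lt; auto. apply ozero_olt, eps_pos, Ha. }
    destruct (isP_ex HP) as [Z EZ]. destruct (cnf_ex Z) as [t Ht].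
    assert (Hlen : t <> []).
    { intros ->. apply HL1. rewrite EZ. unfold oone. f_equal. apply Ht. }
    assert (Hlen' : 0 < length t) by (destruct t; simpl; [tauto|lia]).
    (* [L] itself is the cover point for all copies of the last term of its exponent. *)
    set (k := length t - 1).
    assert (Hin : In (nth k t (ozero, 0)) t) by (apply nth_In; unfold k; lia).
    destruct (HF s L l Z t k (snd (nth k t (ozero, 0)))) as (V & EV & _ & _ & H & _); auto.
    { unfold k; lia. }
    { destruct (nth k t (ozero, 0)) as [M v]. destruct (cnf_term Ht Hin) as (_ & Hv & _).
      simpl. lia. }
    rewrite EV, <- cnfsum_firstn_S in H by (unfold k; lia).
    replace (S k) with (length t) in H by (unfold k; lia). rewrite firstn_all in H.
    replace (cnfsum t) with Z in H by apply Ht. now subst L. }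
  (* The terms of the normal form are recorded too, as [subst_le_C2] needs them for the points of
     [InC2 sigma]. *)
  assert (HC1 : forall x, InC1 d x -> subst_le x /\
    exists s, is_cnf x s /\ forall L l, In (L, l) s -> subst_le L).
  { intros x (s & L & l & Hs & HL & HLe & HFx).
    assert (Hsingle : forall M, isP M -> subst_le M ->
      subst_le M /\ exists s, is_cnf M s /\ forall L l, In (L, l) s -> subst_le L).
    { intros M HM Hok. split; auto. exists [(M, 1)]. split.
      - rewrite <- (natmul_1 M) at 1. apply is_cnf_single; auto.
      - intros L' l' [E|[]]. now injection E as <- _. }
    destruct HFx as [(_ & ->)|(_ & HL1 & Z & t & k & j & EZ & Ht & Hk & Hj & Hx)].
    { apply Hsingle; eauto. now apply (cnf_term Hs) in HL. }
    destruct (HF s L l Z t k j) as (V & EV & HY & HM & Hpre & HV); auto.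
    rewrite <- EV in Hx. simpl in Hx.
    set (pre := cnfsum (firstn k t) [+] natmul (oexp V) j) in *.
    assert (Hx' : x = oexp pre \/ x = oexp pre [+] V).
    { destruct Hx as [->|(V' & EV' & ->)]; auto. apply oexp_inj in EV'. subst; auto. }
    clear Hx. destruct Hx' as [->| ->]; [apply Hsingle; auto using isP_oexp|].
    destruct HV as [->|[HV HXV]]; [rewrite oadd_0_r; apply Hsingle; auto using isP_oexp|].
    split; auto. destruct (cnf_ex V) as [r Hr].
    assert (HVpre : V <<= oexp pre).
    { apply multI_mult in HM. destruct HM as [H0 HM].
      specialize (HM ozero (ozero_olt H0)). rewrite oadd_0_l in HM.
      pose proof (ole_oexp V). pose proof (ole_oexp pre). ord. }
    destruct (cnf_add_head (isP_oexp pre) Hr) as (r' & Hr' & Hterms).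
    { intros [M n] Hq. destruct (cnf_term Hr Hq) as (_ & _ & H). simpl. ord. }
    exists r'. split; auto. intros M n Hin.
    destruct (Hterms M n Hin) as [->|[n' Hin']]; auto.
    apply (HYok V HY), C_2. exists r. split; auto. left. exists M, n', 1.
    destruct (cnf_term Hr Hin') as (_ & Hn & _). rewrite natmul_1. repeat split; auto. }
  intros x Hx. destruct Hx as [x Hx|sg x Hsg Hx|x Hx|V x HV Hx].
  - now apply HC1.
  - destruct (HC1 sg Hsg) as (_ & s & Hs & HsL). apply (subst_le_C2 Hs HsL); auto.
    intros y Hy. apply HD. eapply C_12; eauto.
  - destruct (cnf_ex d) as [s Hs]. apply (subst_le_C2 Hs); eauto.
    intros y Hy. now apply HD, C_2.
  - eauto.
Qed.

(** * The substitution as an isomorphism *)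

Lemma lift_lt_iff x y : dom x -> dom y -> (x << y <-> lift x << lift y).
Proof. intros Hx Hy; split; eauto using lift_mono, lift_lt_inv. Qed.

Lemma lift_ole_iff x y : dom x -> dom y -> (x <<= y <-> lift x <<= lift y).
Proof.
  intros Hx Hy; split; [now apply lift_ole|]. intro H. apply not_olt. intro L.
  apply lift_mono in L; auto. ord.
Qed.

Lemma lift_lt1_above x y : dom x -> dom y -> e << x -> (lt1 x y <-> lt1 (lift x) (lift y)).
Proof.
  intros Hx Hy L. destruct (classic (isP x)) as [HP|HP].
  - destruct (isP_ex HP) as [c ->]. pose proof (dom_exp_inv Hx) as Hc.
    assert (Hc0 : c <> ozero).
    { intros ->. assert (oexp ozero << e); [|ord].
      apply eps_oexp_lt; auto. apply ozero_olt, eps_pos, He. }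
    assert (Hcc : c << oexp c).
    { apply oexp_gt. intro E. apply (dom_noneps Hx L). unfold is_eps in *. congruence. }
    destruct (last_term_ex Hc0) as (c0 & W & E & HW).
    assert (Hdc0 : dom c0) by (apply dom_ole with c; auto; rewrite E; apply ole_oadd_l).
    assert (HdeW : dom (oexp W)) by (apply dom_ole with c; auto; rewrite E; apply ole_oadd_r).
    pose proof (dom_exp_inv HdeW) as HdW.
    rewrite (lift_exp Hc), (lt1_noneps_principal y E HW Hcc).
    rewrite (@lt1_noneps_principal _ (lift c) (lift c0) (lift W)).
    + rewrite <- (lift_exp Hc), <- lift_add, <- lift_lt_iff, <- lift_ole_iff; auto using dom_add.
      tauto.
    + rewrite E at 1. now rewrite lift_add, lift_exp.
    + now apply lift_multI.
    + rewrite <- lift_exp by assumption. now apply lift_mono.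
  - split; intro H; exfalso; apply HP.
    + destruct (lt1_principal H) as (c & -> & _). apply isP_oexp.
    + destruct (lt1_principal H) as (c & E & _). apply lift_isP_inv; auto.
      rewrite E. apply isP_oexp.
Qed.

Lemma lift_lt1 m x y : D m -> (forall z, D z -> z <<= m) -> le1 alpha m ->
  (forall z, D z -> subst_le z) -> dom x -> dom y -> D (lift x) -> D (lift y) ->
  (lt1 (lift x) (lift y) <-> lt1 x y).
Proof.
  intros Hm Hmax Ham Hok Hx Hy HDx HDy.
  (* [alpha <=_1 m] restricts to every point of [D] above [alpha]. *)
  assert (Hay : forall z, D z -> alpha << z -> lt1 alpha z).
  { intros z Hz L. specialize (Hmax z Hz). destruct Ham as [H|H].
    - now apply lt1_ole_right with m.
    - exfalso. subst. ord. }
  assert (Hyh : y <<= h (lift y)).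
  { destruct (Hok _ HDy) as (_ & y' & Dy' & E & H). now apply lift_inj in E as <-. }
  destruct (olt_or_ge x y) as [Lxy|Lxy].
  2: { pose proof (lift_ole Hx Lxy). split; intro H1; apply lt1_olt in H1; exfalso; ord. }
  destruct (olt_total T x e) as [L|[->|L]].
  - destruct (olt_or_ge y e) as [Ly|Ly].
    { rewrite !lift_lt by assumption. tauto. }
    rewrite (lift_lt L) in *.
    assert (Hxa : x << alpha) by ord.
    split; intro H.
    (* Apply [h], which fixes [x], and restrict from [h (lift y)] to [y]. *)
    + apply h_lt1 in H; auto. rewrite (Hfix HDx Hxa) in H.
      now apply lt1_ole_right with (h (lift y)).
    (* Restrict to [e = h alpha], pull back to [x <_1 alpha], and extend by [alpha <=_1 lift y]. *)
    + assert (H1 : lt1 (h x) (h alpha)).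
      { rewrite (Hfix HDx Hxa), Eh. now apply lt1_ole_right with y. }
      apply h_lt1 in H1; auto. apply le1_lt1_trans with alpha; auto.
      destruct Ly as [Ly| <-]; [|right; now rewrite lift_e].
      left. apply Hay; auto. rewrite <- lift_e. now apply lift_mono.
  - pose proof (lift_mono Hy Lxy) as Lm. rewrite lift_e in *.
    (* At [x = e] both relations hold outright. *)
    assert (H : lt1 alpha (lift y)) by auto.
    split; intros _; auto. apply h_lt1 in H; auto. rewrite Eh in H.
    now apply lt1_ole_right with (h (lift y)).
  - symmetry. now apply lift_lt1_above.
Qed.

Lemma subst_le_Subst_iso m : D m -> (forall z, D z -> z <<= m) -> le1 alpha m ->
  (forall z, D z -> subst_le z) ->
  exists H, (forall x, D x -> Subst alpha e x (H x)) /\ iso_lt_lt1_add_exp D H /\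
    (forall x, D x -> x << alpha -> H x = x).
Proof.
  intros Hm Hmax Ham Hok.
  (* [H] inverts [lift] on [D], so its properties are those of [lift] read backwards; off [D] its
     value is arbitrary. *)
  destruct (choice (fun x y => D x -> dom y /\ lift y = x)) as [H HH].
  { intro x. destruct (classic (D x)) as [Hx|Hx]; [|exists ozero; tauto].
    destruct (Hok x Hx) as (_ & y & Hd & E & _). eauto. }
  assert (Hd : forall x, D x -> dom (H x)) by (intros; now apply HH).
  assert (Hl : forall x, D x -> lift (H x) = x) by (intros; now apply HH).
  exists H. split; [|split; [split; [split; [|split; [|split]]|]|]].
  - intros x Hx. rewrite <- (Hl x Hx) at 1. apply lift_Subst; auto.
  - intros x y Hx Hy E. rewrite <- (Hl x Hx), <- (Hl y Hy). congruence.
  - intros x y Hx Hy. rewrite (lift_lt_iff (Hd x Hx) (Hd y Hy)), !Hl; tauto.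
  - intros x y Hx Hy. rewrite <- (@lift_lt1 m (H x) (H y)), !Hl; auto; try tauto;
      rewrite Hl; auto.
  - intros x y z Hx Hy Hz. split; intro E.
    + apply lift_inj; auto using dom_add. rewrite lift_add, !Hl; auto.
    + rewrite <- (Hl x Hx), <- (Hl y Hy), <- (Hl z Hz), <- lift_add, E; auto.
  - intros x y Hx Hy. split; intro E.
    + apply lift_inj; auto using dom_exp. rewrite lift_exp, !Hl; auto.
    + rewrite <- (Hl x Hx), <- (Hl y Hy), <- lift_exp, E; auto.
  - intros x Hx L. rewrite <- (Hl x Hx) in L at 1. rewrite <- (Hl x Hx) at 2.
    symmetry. apply lift_lt. apply lift_lt_alpha; auto.
Qed.

End Lift.

Unset Implicit Arguments.

Theorem mainTheorem7 (T : OrdStr) (alpha ap : T) (B : list T)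
  (Halpha : is_eps alpha) (Hap : next_eps alpha ap)
  (HB : forall x, In x B -> olt x ap)
  (HBne : exists d, In d B /\ ole alpha d /\ olt d ap)
  (h : T -> T)
  (Hiso : iso_lt_lt1_add (InDelta alpha ap B) h)
  (Himg : forall x, InDelta alpha ap B x -> olt (h x) alpha)
  (Hfix : forall x, InDelta alpha ap B x -> olt x alpha -> h x = x) :
  (olt (h alpha) alpha /\ is_eps (h alpha)) /\
  (forall x, InDelta alpha ap B x ->
     (forall e, InEp e x -> olt e alpha -> olt e (h alpha)) /\
     (exists y, Subst alpha (h alpha) x y /\ ole y (h x))) /\
  ((exists m, InDelta alpha ap B m /\
      (forall x, InDelta alpha ap B x -> ole x m) /\ le1 alpha m) ->
   exists H : T -> T,
     (forall x, InDelta alpha ap B x -> Subst alpha (h alpha) x (H x)) /\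
     iso_lt_lt1_add_exp (InDelta alpha ap B) H /\
     (forall x, InDelta alpha ap B x -> olt x alpha -> H x = x)).
Proof.
  destruct HBne as (d0 & Hd0 & Had0 & Hdap0).
  assert (HDC : forall d, In d B -> alpha <<= d -> forall x, InC d x -> InDelta alpha ap B x).
  { intros d Hd Had x Hx. right. exists d. unfold InD. auto 10. }
  assert (HDa : InDelta alpha ap B alpha).
  { right. exists d0. unfold InD. auto 10. }
  assert (HD2a : InDelta alpha ap B (alpha [+] alpha)).
  { right. exists d0. unfold InD. auto 10. }
  assert (He : is_eps (h alpha)).
  { apply lt1_double_eps. rewrite <- (h_add Hiso); auto.
    apply (proj1 (h_lt1 Hiso HDa HD2a)). now apply eps_lt1_double. }
  assert (Hea : h alpha << alpha) by auto.
  assert (Hok : forall x, InDelta alpha ap B x ->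
    subst_le (h alpha) alpha (InDelta alpha ap B) h x).
  { assert (HokC : forall d, In d B -> alpha <<= d -> forall x, InC d x ->
      subst_le (h alpha) alpha (InDelta alpha ap B) h x).
    { intros d Hd Had. apply subst_le_C with ap; eauto. }
    intros x Hx. destruct (olt_or_ge x alpha) as [L|L]; [now apply subst_le_lt|].
    destruct Hx as [Hx|(d & Hd & Had & Hdap & [Hx|[->| ->]])].
    (* A point of [B] from [alpha] on belongs to its own cover set. *)
    - apply (HokC x); auto. apply InC_self. intros ->.
      apply (eps_pos Halpha). apply ole_antisym; auto using ozero_ole.
    - now apply (HokC d).
    - now apply subst_le_alpha.
    - apply subst_le_add; auto; now apply subst_le_alpha. }
  split; [auto|split].
  - intros x Hx. destruct (Hok x Hx) as (_ & y & Hy & <- & Hle). split.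
    + intros e' H1 H2. exact (lift_Ep He Halpha Hea Hy H1 H2).
    + exists y. split; auto. now apply lift_Subst.
  - intros (m & Hm & Hmax & Ham). exact (subst_le_Subst_iso He Halpha Hea HDa Hiso Hfix eq_refl Hm Hmax Ham Hok).
Qed.
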